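(* Let $\mu>0$ be such that $c\mu<1$, $k_1:=\frac{c\mu}{1-c\mu}<1$ and $1<-\frac{2}{\lambda_1}\log k_1$. Let $d>0$ and $\nu\in[0,\frac{d\lambda_1}{2})$ with $\nu+d>1$, and suppose that for every $\omega\in\Omega$ $$1>\liminf_{i\to-\infty}\frac{|T_i(\omega)|}{|i|}\ge d\ge\frac{2(\log(1+k_1)+\nu)}{\lambda_1},\qquad \lim_{i\to-\infty}\frac{\log^+\big(|T(\theta_{T_i(\omega)}\omega)|^{-\beta}\big)}{|i|}=0 .$$ For $\omega\in\Omega$ let $\{\mathcal A(i,\omega)\}_{i\in\mathbb Z}$ be the pullback attractor of $\Phi(\cdot,\cdot,\omega,\cdot)$ with respect to $\mathcal D^\nu_{\mathbb Z,V}$, and define $\mathcal A(\omega):=\mathcal A(0,\omega)$. Then $\mathcal A=(\mathcal A(\omega))_{\omega\in\Omega}$ is invariant and attracting for elements of $\mathcal D^0_{\mathbb R,V}$ with respect to $\varphi$, i.e. $\varphi(t,\omega,\mathcal A(\omega))=\mathcal A(\theta_t\omega)$ for all $t\ge0$, $\omega\in\Omega$, and $\lim_{t\to\infty}\mathrm{dist}(\varphi(t,\theta_{-t}\omega,D(\theta_{-t}\omega)),\mathcal A(\omega))=0$ for all $\omega\in\Omega$, $D\in\mathcal D^0_{\mathbb R,V}$.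
   Context: **Equation.** $(V,(\cdot,\cdot),|\cdot|)$ is a separable Hilbert space, $L_2(V)$ the Hilbert–Schmidt operators on $V$. $-A$ is a strictly positive symmetric (self-adjoint) operator on $V$ with compact inverse, $A$ generates the analytic, exponentially decreasing semigroup $S$; $\lambda_1>0$ is the smallest eigenvalue of $-A$; $V_\delta=D((-A)^\delta)$ with $|x|_{V_\delta}=|(-A)^\delta x|$. $G:V\to L_2(V)$ is twice continuously Fréchet differentiable with bounded first and second derivatives. Fix $H\in(1/2,1)$, $1/2<\beta<\beta'<\beta''<H$ and $1-\beta'<\alpha<\beta$. Put $|||u|||_{\gamma,T_1,T_2}=\sup_{T_1\le s<t\le T_2}\frac{|u(t)-u(s)|}{|t-s|^\gamma}$, $\|u\|_{\beta,T_1,T_2}=\sup_{[T_1,T_2]}|u|+|||u|||_{\beta,T_1,T_2}$, $\|u\|_{\beta,\sim,T_1,T_2}=\sup_{[T_1,T_2]}|u|+\sup_{T_1<s<t\le T_2}(s-T_1)^\beta\frac{|u(t)-u(s)|}{|t-s|^\beta}$; $C^\beta$, $C^{\beta,\sim}$ are the spaces of continuous functions with these norms finite. $\theta_t\omega(\cdot)=\omega(t+\cdot)-\omega(t)$, and $\Omega$ is a $(\theta_t)_{t\in\mathbb R}$-invariant set of paths $\omega:\mathbb R\to V$ that are $\beta''$-Hölder continuous on compact intervals with $\omega(0)=0$. Integrals are defined by $$\int_{T_1}^{T_2}K\,d\omega=(-1)^\alpha\int_{T_1}^{T_2}D^\alpha_{T_1+}K[r]\,D^{1-\alpha}_{T_2-}\omega_{T_2-}[r]\,dr,$$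 $D^\alpha_{T_1+}K[r]=\frac1{\Gamma(1-\alpha)}\big(\frac{K(r)}{(r-T_1)^\alpha}+\alpha\int_{T_1}^r\frac{K(r)-K(q)}{(r-q)^{1+\alpha}}dq\big)$, $D^{1-\alpha}_{T_2-}\omega_{T_2-}[r]=\frac{(-1)^{1-\alpha}}{\Gamma(\alpha)}\big(\frac{\omega(r)-\omega(T_2)}{(T_2-r)^{1-\alpha}}+(1-\alpha)\int_r^{T_2}\frac{\omega(r)-\omega(q)}{(q-r)^{2-\alpha}}dq\big)$, where $(-1)^\alpha(-1)^{1-\alpha}=-1$. The equation $du=Au\,dt+G(u)\,d\omega$, $u(0)=u_0$, is solved in the mild sense $u(t)=S(t)u_0+\int_0^tS(t-r)G(u(r))\,d\omega$. It is known that for $u_0\in V$ there is for every $T>0$ a unique solution in $C^{\beta,\sim}([0,T];V)$ (in $C^\beta([0,T];V)$ if $u_0\in V_\beta$). Set $\varphi(t,\omega,u_0)=u(t)$; this satisfies $\varphi(t+\tau,\omega,u_0)=\varphi(t,\theta_\tau\omega,\varphi(\tau,\omega,u_0))$, $\varphi(0,\omega,u_0)=u_0$. **Stopping times.** For $\mu>0$: $T(\omega)=\inf\{\tau>0:|||\omega|||_{\beta',0,\tau}+\mu\tau^{1-\beta'}\ge\mu\}$, $\hat T(\omega)=\sup\{\tau<0:|||\omega|||_{\beta',\tau,0}+\mu|\tau|^{1-\beta'}\ge\mu\}$; $T_0(\omega)=0$, $T_i(\omega)=T_{i-1}(\omega)+T(\theta_{T_{i-1}(\omega)}\omega)$ for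 $i\ge1$, $T_i(\omega)=T_{i+1}(\omega)+\hat T(\theta_{T_{i+1}(\omega)}\omega)$ for $i\le-1$. They satisfy $T_i(\omega)+T_j(\theta_{T_i(\omega)}\omega)=T_{i+j}(\omega)$ for $i,j\in\mathbb Z$. **The constant $c$.** $c>0$ is a fixed constant, depending only on $S,G$ and the Hölder parameters (not on $\omega,i,j,u_0,\mu$), such that for all $\omega\in\Omega$, $j\in\mathbb Z$, $i\ge1$, $u_0\in V_\beta$, the solution $u$ driven by $\theta_{T_j(\omega)}\omega$ satisfies, with $t_m=T_m(\theta_{T_j(\omega)}\omega)$, $\|u\|_{\beta,t_{i-1},t_i}\le ce^{-\lambda_1t_{i-1}}|u_0|_{V_\beta}+c\mu\|u\|_{\beta,t_{i-1},t_i}+\sum_{m=1}^{i-1}c\mu e^{-\lambda_1(t_{i-1}-t_m)}(1+\|u\|_{\beta,t_{m-1},t_m})+c\mu$ (such $c$ exists). **Set systems and attractors.** $\Phi(i,j,\omega,u_0)=\varphi(T_i(\theta_{T_j(\omega)}\omega),\theta_{T_j(\omega)}\omega,u_0)$ for $i\in\mathbb Z^+$, $j\in\mathbb Z$, $u_0\in V$. $\mathcal D^\nu_{\mathbb Z,V}$ is the set of families $(D(i))_{i\in\mathbb Z}$ of nonempty subsets of $V$ with $D(i)\subset B_V(0,r(i))$ for some $r(i)$ with $\limsup_{i\to-\infty}\frac{\log^+r(i)}{|i|}<\nu$. $\mathcal D^0_{\mathbb R,V}$ is the set of families $(D(\omega))_{\omega\in\Omega}$ of nonempty closed subsets of $V$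 with $D(\omega)\subset B_V(0,r(\omega))$ for some $r:\Omega\to\mathbb R^+$ with $\limsup_{t\to-\infty}\frac{\log^+r(\theta_t\omega)}{|t|}=0$ for all $\omega\in\Omega$. With $\mathrm{dist}(X,Y)=\sup_{x\in X}\inf_{y\in Y}|x-y|$, the pullback attractor of $\Phi(\cdot,\cdot,\omega,\cdot)$ with respect to $\mathcal D^\nu_{\mathbb Z,V}$ is the (unique) family $(\mathcal A(j,\omega))_{j\in\mathbb Z}\in\mathcal D^\nu_{\mathbb Z,V}$ of nonempty compact sets with $\Phi(i,j,\omega,\mathcal A(j,\omega))=\mathcal A(i+j,\omega)$ for all $i\in\mathbb Z^+,j\in\mathbb Z$ and $\lim_{i\to\infty}\mathrm{dist}(\Phi(i,j-i,\omega,D(j-i)),\mathcal A(j,\omega))=0$ for all $j\in\mathbb Z$ and $D\in\mathcal D^\nu_{\mathbb Z,V}$; it exists under the assumptions of the claim. *)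

(* Defs.v *)
From HB Require Import structures.
From mathcomp Require Export all_boot all_order all_algebra.
From mathcomp Require Export all_classical all_reals all_analysis.

Set Implicit Arguments.
Unset Strict Implicit.
Unset Printing Implicit Defensive.

Import Order.TTheory GRing.Theory Num.Theory.
Import numFieldNormedType.Exports.

Local Open Scope classical_set_scope.
Local Open Scope ring_scope.

Section Hilbert.
Context {R : realType} {V : completeNormedModType R}.
Implicit Types (ip : V -> V -> R) (DA : set V) (A : V -> V).

(* [V] is complete, so this makes it a (real) Hilbert space. *)
Record inner_product ip : Prop := InnerProduct {
  ip_sym : forall x y, ip x y = ip y x ;
  ip_lin : forall (a : R) x y z, ip (a *: x + y) z = a * ip x z + ip y z ;
  ip_norm : forall x, ip x x = `|x| ^+ 2 }.

Definition separable : Prop := exists s : nat -> V, dense (range s).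

(* The unbounded operator A is a function together with its domain D(A);
   its values outside the domain are irrelevant. *)
Record unbounded_linear DA A : Prop := UnboundedLinear {
  dom_zero : DA 0 ;
  dom_lin : forall (a : R) x y, DA x -> DA y ->
    DA (a *: x + y) /\ A (a *: x + y) = a *: A x + A y }.

(* The second clause is D(A^* ) `<=` D(A), so that A = A^*. *)
Definition self_adjoint ip DA A : Prop :=
  [/\ dense DA,
      forall x y, DA x -> DA y -> ip (A x) y = ip x (A y) &
      forall y z, (forall x, DA x -> ip (A x) y = ip x z) -> DA y /\ A y = z].

Definition strictly_positive_opp ip DA A : Prop :=
  forall x, DA x -> x != 0 -> 0 < ip (- A x) x.

Definition compact_operator (B : V -> V) : Prop :=
  linear B /\ compact (closure (B @` [set x | `|x| <= 1])).

Definition compact_inverse DA A : Prop :=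
  exists B : V -> V, [/\ compact_operator B,
    forall x, DA (B x) /\ A (B x) = x & forall x, DA x -> B (A x) = x].

Definition eigenvalue_opp DA A (l : R) : Prop :=
  exists x, [/\ DA x, x != 0 & - A x = l *: x].

Definition smallest_eigenvalue_opp DA A (l : R) : Prop :=
  eigenvalue_opp DA A l /\ forall l', eigenvalue_opp DA A l' -> l <= l'.

(* A complete orthonormal system of eigenvectors of -A; the index type is a
   countType so that V may be finite dimensional. Every self-adjoint -A with
   compact inverse has one, and the notions below that mention it (fractional
   powers, Hilbert-Schmidt norm) do not depend on which one is taken. *)
Record eigenbasis_opp ip DA A (I : countType) (e : I -> V) (lam : I -> R)
    : Prop := EigenbasisOpp {
  eigb_orth : forall i j, ip (e i) (e j) = (i == j)%:R ;
  eigb_total : forall x, (forall i, ip x (e i) = 0) -> x = 0 ;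
  eigb_eig : forall i, DA (e i) /\ - A (e i) = lam i *: e i }.

(* [S t] is only used for t >= 0. Since V is a real space, analyticity is
   expressed by the smoothing estimate for A S(t). *)
Record generates_semigroup DA A (S : R -> V -> V) : Prop :=
    GeneratesSemigroup {
  sg_linear : forall t, 0 <= t -> linear (S t) ;
  sg_continuous : forall t, 0 <= t -> continuous (S t) ;
  sg_zero : forall x, S 0 x = x ;
  sg_add : forall s t x, 0 <= s -> 0 <= t -> S (s + t) x = S s (S t x) ;
  sg_strong : forall x, S t x @[t --> 0^'+] --> x ;
  sg_generator : forall x y,
    (DA x /\ A x = y) <-> (h^-1 *: (S h x - x) @[h --> 0^'+] --> y) ;
  sg_analytic : exists M : R, forall t x, 0 < t <= 1 ->
    DA (S t x) /\ t * `|A (S t x)| <= M * `|x| ;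
  sg_decay : exists M k : R, 0 < k /\
    forall t x, 0 <= t -> `|S t x| <= M * expR (- k * t) * `|x| }.

Section Spectral.
Context (ip : V -> V -> R) {I : countType} (e : I -> V) (lam : I -> R).

(* y = (-A)^delta x *)
Definition frac_power_graph (delta : R) (x y : V) : Prop :=
  forall i, ip y (e i) = lam i `^ delta * ip x (e i).

Definition Vdom (delta : R) : set V :=
  [set x | exists y, frac_power_graph delta x y].

Definition frac_power (delta : R) (x : V) : V :=
  xget 0 [set y | frac_power_graph delta x y].

Definition Vnorm (delta : R) (x : V) : R := `|frac_power delta x|.

Definition hs_sqnorm (B : V -> V) : \bar R :=
  (\esum_(i in [set: I]) (`|B (e i)| ^+ 2)%:E)%E.

Definition hilbert_schmidt (B : V -> V) : Prop :=
  [/\ linear B, continuous B & (hs_sqnorm B < +oo)%E].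

Definition hs_norm (B : V -> V) : R := Num.sqrt (fine (hs_sqnorm B)).

(* Sums and differences of operators are pointwise. [DG x h] and [D2G x h k]
   are the derivatives DG(x)h and D^2G(x)(h,k), with values in L_2(V). *)
Record C2_bounded_derivatives (G : V -> V -> V) (DG : V -> V -> V -> V)
    (D2G : V -> V -> V -> V -> V) : Prop := C2BoundedDerivatives {
  G_hs : forall x, hilbert_schmidt (G x) ;
  DG_hs : forall x h, hilbert_schmidt (DG x h) ;
  D2G_hs : forall x h k, hilbert_schmidt (D2G x h k) ;
  DG_lin : forall x, linear (DG x) ;
  D2G_linl : forall x k, linear (fun h => D2G x h k) ;
  D2G_linr : forall x h, linear (D2G x h) ;
  DG_deriv : forall x (eps : R), 0 < eps -> \forall h \near (0 : V),
    hs_norm (G (x + h) - G x - DG x h) <= eps * `|h| ;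
  D2G_deriv : forall x (eps : R), 0 < eps -> \forall h \near (0 : V),
    forall k, hs_norm (DG (x + h) k - DG x k - D2G x h k)
              <= eps * `|h| * `|k| ;
  D2G_cont : forall x (eps : R), 0 < eps -> \forall y \near x,
    forall h k, hs_norm (D2G y h k - D2G x h k) <= eps * `|h| * `|k| ;
  DG_bounded : exists M : R, forall x h, hs_norm (DG x h) <= M * `|h| ;
  D2G_bounded : exists M : R, forall x h k,
    hs_norm (D2G x h k) <= M * `|h| * `|k| }.

Definition C2b (G : V -> V -> V) : Prop :=
  exists DG D2G, C2_bounded_derivatives G DG D2G.

End Spectral.
End Hilbert.

Arguments separable {R} V.

Section Hoelder.
Context {R : realType} {V : completeNormedModType R}.

(* These are meant for T1 < T2: the supremum of the empty set is -oo. *)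
Definition hseminorm (g : R) (u : R -> V) (T1 T2 : R) : \bar R :=
  ereal_sup [set z | exists s t, [/\ T1 <= s, s < t, t <= T2 &
    z = (`|u t - u s| / (t - s) `^ g)%:E]].

Definition wseminorm (g : R) (u : R -> V) (T1 T2 : R) : \bar R :=
  ereal_sup [set z | exists s t, [/\ T1 < s, s < t, t <= T2 &
    z = ((s - T1) `^ g * (`|u t - u s| / (t - s) `^ g))%:E]].

Definition supnorm (u : R -> V) (T1 T2 : R) : \bar R :=
  ereal_sup [set (`|u t|)%:E | t in `[T1, T2]].

Definition hnorm (g : R) (u : R -> V) (T1 T2 : R) : \bar R :=
  (supnorm u T1 T2 + hseminorm g u T1 T2)%E.

Definition wnorm (g : R) (u : R -> V) (T1 T2 : R) : \bar R :=
  (supnorm u T1 T2 + wseminorm g u T1 T2)%E.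

Definition Chol (g T1 T2 : R) : set (R -> V) :=
  [set u | {within `[T1, T2], continuous u} /\ (hnorm g u T1 T2 < +oo)%E].

Definition Cwhol (g T1 T2 : R) : set (R -> V) :=
  [set u | {within `[T1, T2], continuous u} /\ (wnorm g u T1 T2 < +oo)%E].

Definition theta (t : R) (w : R -> V) : R -> V := fun s => w (t + s) - w t.

Definition path_space (g : R) (Omega : set (R -> V)) : Prop :=
  [/\ forall w, Omega w -> w 0 = 0,
      forall w, Omega w -> forall a b, a < b -> (hseminorm g w a b < +oo)%E &
      forall t w, Omega w -> Omega (theta t w)].

End Hoelder.

Section Integral.
Context {R : realType} {V : completeNormedModType R} (ip : V -> V -> R).

Definition Gamma (a : R) : R :=
  \int[lebesgue_measure]_(t in `]0%R, +oo[) (t `^ (a - 1) * expR (- t)).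

(* Bochner integrability and integral of f : [a, b] -> V. As V is separable,
   strong measurability is weak measurability (Pettis), and the Bochner
   integral of f is the vector representing v |-> \int (f(r), v) dr. *)
Definition bochner (a b : R) (f : R -> V) (y : V) : Prop :=
  [/\ forall v, measurable_fun (`[a, b]%classic : set R)
                  (fun r => ip (f r) v),
      lebesgue_measure.-integrable (`[a, b]%classic : set R)
        (fun r => (`|f r|)%:E) &
      forall v, ip y v = \int[lebesgue_measure]_(r in `[a, b]) ip (f r) v].

Definition bint (a b : R) (f : R -> V) : V := xget 0 [set y | bochner a b f y].

(* D^alpha_{T1+} K [r], an operator on V, given by its action on x. *)
Definition fracL (alpha T1 : R) (K : R -> V -> V) (r : R) (x : V) : V :=
  (Gamma (1 - alpha))^-1 *:
    (((r - T1) `^ alpha)^-1 *: K r x +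
     alpha *: bint T1 r (fun q =>
       ((r - q) `^ (1 + alpha))^-1 *: (K r x - K q x))).

(* D^(1-alpha)_{T2-} w_{T2-} [r] without its factor (-1)^(1-alpha). *)
Definition fracR (alpha T2 : R) (w : R -> V) (r : R) : V :=
  (Gamma alpha)^-1 *:
    (((T2 - r) `^ (1 - alpha))^-1 *: (w r - w T2) +
     (1 - alpha) *: bint r T2 (fun q =>
       ((q - r) `^ (2 - alpha))^-1 *: (w r - w q))).

(* The sign is the product (-1)^alpha (-1)^(1-alpha) = -1. *)
Definition wint (alpha T1 T2 : R) (K : R -> V -> V) (w : R -> V) : V :=
  - bint T1 T2 (fun r => fracL alpha T1 K r (fracR alpha T2 w r)).

Definition mild (alpha : R) (S : R -> V -> V) (G : V -> V -> V)
    (w : R -> V) (u0 : V) (T : R) (u : R -> V) : Prop :=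
  forall t, 0 <= t <= T ->
    u t = S t u0 + wint alpha 0 t (fun r x => S (t - r) (G (u r) x)) w.

(* phi(., w, u0) is the unique global mild solution, with its regularity and
   the cocycle property. [Vb] is the space of regular initial data. *)
Record solution_cocycle (alpha beta : R) (S : R -> V -> V) (G : V -> V -> V)
    (Vb : set V) (Omega : set (R -> V)) (phi : R -> (R -> V) -> V -> V)
    : Prop := SolutionCocycle {
  sol_mild : forall w u0 T, Omega w -> 0 < T ->
    Cwhol beta 0 T (fun t => phi t w u0) /\
    mild alpha S G w u0 T (fun t => phi t w u0) ;
  sol_unique : forall w u0 T u, Omega w -> 0 < T ->
    Cwhol beta 0 T u -> mild alpha S G w u0 T u ->
    forall t, 0 <= t <= T -> u t = phi t w u0 ;
  sol_regular : forall w u0 T, Omega w -> 0 < T -> Vb u0 ->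
    Chol beta 0 T (fun t => phi t w u0) ;
  sol_zero : forall w u0, Omega w -> phi 0 w u0 = u0 ;
  sol_cocycle : forall w u0 t tau, Omega w -> 0 <= t -> 0 <= tau ->
    phi (t + tau) w u0 = phi t (theta tau w) (phi tau w u0) }.

End Integral.

Section StoppingTimes.
Context {R : realType} {V : completeNormedModType R}.

Definition stop (beta' mu : R) (w : R -> V) : R :=
  inf [set tau : R | 0 < tau /\
    (mu%:E <= hseminorm beta' w 0 tau + (mu * tau `^ (1 - beta'))%:E)%E].

Definition stop_back (beta' mu : R) (w : R -> V) : R :=
  sup [set tau : R | tau < 0 /\
    (mu%:E <= hseminorm beta' w tau 0 + (mu * `|tau| `^ (1 - beta'))%:E)%E].

Fixpoint stop_pos (beta' mu : R) (w : R -> V) (n : nat) : R :=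
  if n is m.+1 then
    let s := stop_pos beta' mu w m in s + stop beta' mu (theta s w)
  else 0.

Fixpoint stop_neg (beta' mu : R) (w : R -> V) (n : nat) : R :=
  if n is m.+1 then
    let s := stop_neg beta' mu w m in s + stop_back beta' mu (theta s w)
  else 0.

Definition Tstop (beta' mu : R) (i : int) (w : R -> V) : R :=
  match i with
  | Posz n => stop_pos beta' mu w n
  | Negz n => stop_neg beta' mu w n.+1
  end.

(* The a priori estimate characterizing the constant c; Vb and vn stand for
   V_beta and its norm. The constant is uniform in mu as well. *)
Definition apriori_constant (beta beta' lambda1 : R) (Vb : set V)
    (vn : V -> R) (Omega : set (R -> V)) (phi : R -> (R -> V) -> V -> V)
    (c : R) : Prop :=
  0 < c /\
  forall (mu : R) w (j : int) (i : nat) u0,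
    0 < mu -> Omega w -> (1 <= i)%N -> Vb u0 ->
    let w' := theta (Tstop beta' mu j w) w in
    let t (m : nat) := Tstop beta' mu m%:Z w' in
    let u := fun s => phi s w' u0 in
    let N (m : nat) := hnorm beta u (t m.-1) (t m) in
    (N i <= (c * expR (- lambda1 * t i.-1) * vn u0)%:E
            + (c * mu)%:E * N i
            + \sum_(1 <= m < i)
                (c * mu * expR (- lambda1 * (t i.-1 - t m)))%:E * (1 + N m)
            + (c * mu)%:E)%E.

Definition Phi (beta' mu : R) (phi : R -> (R -> V) -> V -> V)
    (i : nat) (j : int) (w : R -> V) (u0 : V) : V :=
  let w' := theta (Tstop beta' mu j w) w in
  phi (Tstop beta' mu i%:Z w') w' u0.

End StoppingTimes.

Section Attractors.
Context {R : realType} {V : completeNormedModType R}.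

Definition logplus (x : R) : R := Num.max (ln x) 0.

(* Limits as i -> -oo in int are taken along i = - n with n : nat. *)
Definition DZ (nu : R) (D : int -> set V) : Prop :=
  (forall i, D i !=set0) /\
  exists r : int -> R, (forall i, D i `<=` [set x | `|x| <= r i]) /\
    (limn_esup (fun n : nat => (logplus (r (- n%:Z)) / n%:R)%:E) < nu%:E)%E.

Definition DR0 (Omega : set (R -> V)) (D : (R -> V) -> set V) : Prop :=
  (forall w, Omega w -> D w !=set0 /\ closed (D w)) /\
  exists r : (R -> V) -> R,
    (forall w, Omega w -> 0 <= r w /\ D w `<=` [set x | `|x| <= r w]) /\
    (forall w, Omega w ->
       limf_esup (fun t : R => (logplus (r (theta t w)) / `|t|)%:E)
         (ninfty_nbhs R) = 0%E).

Definition hdist (X Y : set V) : \bar R :=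
  ereal_sup [set ereal_inf [set (`|x - y|)%:E | y in Y] | x in X].

Record pullback_attractor (nu : R) (P : nat -> int -> V -> V)
    (A : int -> set V) : Prop := PullbackAttractor {
  attr_DZ : DZ nu A ;
  attr_compact : forall j, compact (A j) ;
  attr_invariant : forall (i : nat) (j : int), P i j @` A j = A (i%:Z + j) ;
  attr_attracts : forall (j : int) (D : int -> set V), DZ nu D ->
    hdist (P i (j - i%:Z) @` D (j - i%:Z)) (A j) @[i --> \oo] --> 0%E }.

End Attractors.

(* Main.v *)
(* The attractor of the discrete systems is transported along the flow.  Two
   facts are needed.

   (1) A linear growth bound 1 + |phi(t, w, x)| <= K (1 + |x|) for t up to the
   first stopping time, with K independent of w.  It holds for a short time by
   a Young-type estimate of the mild formula in the weighted Hoelder norm: by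
   the cocycle property u(t) - u(s) = (S(t - s) - 1) u(s) + (integral of the
   path shifted by s), so that additivity of the integral is never used, and
   the first term is handled by the V_beta bound s^(-beta) of u(s).  Iterating
   gives the bound up to time 1.

   (2) The stopping times of w and of theta_t w are orbits of one increasing
   bijection of the line (a |-> a + T(theta_a w)), hence they interlace up to a
   fixed number of steps.

   Flowing A(-n, w) to the stopping times of theta_t w therefore yields a family
   of the same growth class, which is attracted by A(., theta_t w); by
   invariance the image at time t does not depend on n, so phi(t, w, A(w)) is
   contained in A(theta_t w).  The same argument with the roles exchanged gives
   the other inclusion.  For the attraction, all the flows of D(theta_s w) with
   s in the n-th stopping interval to its right end are collected in one set. *)
Require Import Defs.
From mathcomp Require Import ring lra measurable_realfun.
Set Implicit Arguments.
Unset Strict Implicit.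
Unset Printing Implicit Defensive.
Import Order.TTheory GRing.Theory Num.Theory.
Import numFieldNormedType.Exports.
Local Open Scope classical_set_scope.
Local Open Scope ring_scope.

(** The classes of sets are measured only on an exponential scale. Crossing a fixed number q of
    stopping intervals turns a radius r into at most K^q (1 + r), which leaves the exponential rate
    unchanged; this is why a linear growth bound is the right tool. K is uniform in the path because
    a stopping interval has length at most 1 and the path has Hoelder constant at most mu on it.
    Such a q exists because the lower bound d > 0 sends the backward stopping times to minus
    infinity. A family in D^0_R has rate 0 in time, hence, the intervals being no longer than 1,
    rate at most nu / 2 in the index, and nu > 0 follows from d < 1 < nu + d. Bochner integrals are
    chosen vectors with default value 0. Estimates are made by testing against vectors, where they
    hold whether or not the integral exists, so that integrability of the integrands is never
    established; bounds in V_b are stated by duality for the same reason. *)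

(** * Orthogonal expansions in a Hilbert space *)

Section InnerProduct.
Context {R : realType} {V : completeNormedModType R} (ip : V -> V -> R).
Hypothesis hip : inner_product ip.

Lemma ipC x y : ip x y = ip y x. Proof. exact: ip_sym. Qed.

Lemma ip0l z : ip 0 z = 0.
Proof.
by have := ip_lin hip (-1) 0 0 z; rewrite scaler0 addr0 mulN1r addNr.
Qed.

Lemma ipZl a x z : ip (a *: x) z = a * ip x z.
Proof. by have := ip_lin hip a x 0 z; rewrite addr0 ip0l addr0. Qed.

Lemma ipDl x y z : ip (x + y) z = ip x z + ip y z.
Proof. by have := ip_lin hip 1 x y z; rewrite scale1r mul1r. Qed.

Lemma ipNl x z : ip (- x) z = - ip x z.
Proof. by rewrite -scaleN1r ipZl mulN1r. Qed.

Lemma ipBl x y z : ip (x - y) z = ip x z - ip y z.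
Proof. by rewrite ipDl ipNl. Qed.

Lemma ip0r z : ip z 0 = 0. Proof. by rewrite ipC ip0l. Qed.

Lemma ipZr a x z : ip z (a *: x) = a * ip z x.
Proof. by rewrite ipC ipZl ipC. Qed.

Lemma ipBr x y z : ip z (x - y) = ip z x - ip z y.
Proof. by rewrite ipC ipBl !(ipC _ z). Qed.

Lemma ip_suml (J : Type) (r : seq J) (F : J -> V) z :
  ip (\sum_(i <- r) F i) z = \sum_(i <- r) ip (F i) z.
Proof.
elim: r => [|i r IH]; first by rewrite !big_nil ip0l.
by rewrite !big_cons ipDl IH.
Qed.

Lemma cauchy_schwarz x y : `|ip x y| <= `|x| * `|y|.
Proof.
have [->|y0] := eqVneq y 0; first by rewrite ip0r !normr0 mulr0.
have ny : 0 < `|y| by rewrite normr_gt0.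
have : 0 <= ip (`|y| ^+ 2 *: x - ip x y *: y) (`|y| ^+ 2 *: x - ip x y *: y).
  by rewrite (ip_norm hip) sqr_ge0.
rewrite !(ipBl, ipBr, ipZl, ipZr) !(ip_norm hip) (ipC y x).
set a := ip x y; set X := `|x|; set Y := `|y| => h.
have X0 : 0 <= X by exact: normr_ge0.
have h2 : 0 <= Y ^+ 2 * ((X * Y) ^+ 2 - a ^+ 2).
  suff -> : Y ^+ 2 * ((X * Y) ^+ 2 - a ^+ 2) =
    Y ^+ 2 * (Y ^+ 2 * X ^+ 2) - a * (Y ^+ 2 * a) - (Y ^+ 2 * (a * a) - a * (a * Y ^+ 2)).
    by move: h; rewrite /X /Y; congr (0 <= _); ring.
  by ring.
rewrite pmulr_rge0 ?exprn_gt0// subr_ge0 in h2.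
rewrite -ler_sqr ?nnegrE ?mulr_ge0 ?normr_ge0//.
by rewrite -normrX ger0_norm ?sqr_ge0.
Qed.

Lemma ip_inj x y : (forall z, ip x z = ip y z) -> x = y.
Proof.
move=> h; apply/eqP; rewrite -subr_eq0 -normr_eq0 -sqrf_eq0 -(ip_norm hip).
by rewrite ipBl h subrr.
Qed.

Lemma norm_le_ip x c : 0 <= c -> (forall z, `|ip x z| <= c * `|z|) -> `|x| <= c.
Proof.
move=> c0 h; have [->|x0] := eqVneq x 0; first by rewrite normr0.
have := h x; rewrite (ip_norm hip) normrX normr_id expr2.
by rewrite ler_pM2r// normr_gt0.
Qed.

Lemma cvg_ip (u w : V^nat) x y : u @ \oo --> x -> w @ \oo --> y ->
  ip (u n) (w n) @[n --> \oo] --> ip x y.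
Proof.
move=> ux wy; apply/cvgrPdist_le => eps eps0.
have h : (`|u n - x| * `|w n| + `|x| * `|w n - y|) @[n --> \oo] --> (0 : R).
  have -> : 0 = 0 * `|y| + `|x| * 0 :> R by rewrite mul0r mulr0 addr0.
  apply: cvgD; apply: cvgM; try exact: cvg_norm; try exact: cvg_cst.
  - rewrite -(normr0 V); apply: cvg_norm; exact/subr_cvg0.
  - rewrite -(normr0 V); apply: cvg_norm; exact/subr_cvg0.
near=> n; rewrite distrC.
apply: le_trans (_ : `|u n - x| * `|w n| + `|x| * `|w n - y| <= eps); last first.
  rewrite -[leLHS]ger0_norm ?addr_ge0 ?mulr_ge0//.
  by rewrite -[leLHS]normrN -sub0r; near: n; move/cvgrPdist_le : h => /(_ eps eps0).
have -> : ip (u n) (w n) - ip x y = ip (u n - x) (w n) + ip x (w n - y).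
  by rewrite ipBl ipBr; ring.
by rewrite (le_trans (ler_normD _ _))// lerD// cauchy_schwarz.
Unshelve. all: by end_near.
Qed.

Lemma cvg_ipl (u : V^nat) x z : u @ \oo --> x -> ip (u n) z @[n --> \oo] --> ip x z.
Proof. by move=> ux; apply: (cvg_ip ux); exact: cvg_cst. Qed.

Section OrthoSequence.
(* The zero vector is allowed, so that families indexed by an arbitrary
   countable type can be enumerated by [nat]. *)
Variable ee : nat -> V.
Hypothesis orth : forall k l, k != l -> ip (ee k) (ee l) = 0.
Hypothesis unit_or_0 : forall k, ee k = 0 \/ `|ee k| = 1.

(** The Gram entry is 0 or 1, and where it is 0 so is the coefficient; this replaces normalisation
    when zero vectors are allowed. *)
Lemma coef_unit x k : ip x (ee k) * ip (ee k) (ee k) = ip x (ee k).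
Proof.
case: (unit_or_0 k) => [->|h]; first by rewrite !ip0r mul0r.
by rewrite (ip_norm hip) h expr1n mulr1.
Qed.

Lemma ip_psum (a : nat -> R) n k :
  ip (\sum_(i < n) a i *: ee i) (ee k) = if (k < n)%N then a k * ip (ee k) (ee k) else 0.
Proof.
rewrite ip_suml; case: ifP => kn.
  rewrite (bigD1 (Ordinal kn))//= big1 ?addr0 ?ipZl// => i ik.
  by rewrite ipZl orth ?mulr0//; apply: contraNneq ik => /= ->; apply/eqP/val_inj.
rewrite big1// => i _; rewrite ipZl orth ?mulr0//.
by apply/eqP => ik; rewrite -ik ltn_ord in kn.
Qed.

Lemma ip_psum2 (a : nat -> R) n y :
  ip (\sum_(i < n) a i *: ee i) y = \sum_(i < n) a i * ip y (ee i).
Proof. by rewrite ip_suml; apply: eq_bigr => i _; rewrite ipZl ipC. Qed.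

Lemma bessel x n : \sum_(i < n) ip x (ee i) ^+ 2 <= `|x| ^+ 2.
Proof.
set s := \sum_(i < n) ip x (ee i) *: ee i.
pose a k := ip x (ee k).
have sx : ip s x = \sum_(i < n) ip x (ee i) ^+ 2 by exact: (ip_psum2 a).
have ss : ip s s = \sum_(i < n) ip x (ee i) ^+ 2.
  rewrite (ip_psum2 a) -/s; apply: eq_bigr => i _.
  by rewrite (ip_psum a) ltn_ord coef_unit.
have : 0 <= ip (x - s) (x - s) by rewrite (ip_norm hip) sqr_ge0.
by rewrite !(ipBl, ipBr) (ipC x s) sx ss subrr subr0 (ip_norm hip) subr_ge0.
Qed.

Lemma psum_norm (a : nat -> R) m n :
  `|\sum_(m <= i < n) a i *: ee i| ^+ 2 <= \sum_(m <= i < n) a i ^+ 2.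
Proof.
rewrite -(ip_norm hip) ip_suml big_nat [leRHS]big_nat; apply: ler_sum => i imn.
rewrite ipZl ipC ip_suml (bigD1_seq i) ?mem_index_iota ?iota_uniq//= big1 ?addr0.
  rewrite ipZl (ip_norm hip) mulrA -expr2 ler_piMr ?sqr_ge0//.
  by case: (unit_or_0 i) => ->; rewrite ?normr0 ?expr0n ?expr1n.
by move=> k ki; rewrite ipZl orth ?mulr0.
Qed.

Lemma ler_psum_cvg (b : nat -> R) M : (forall n, 0 <= b n) ->
  (forall n, \sum_(i < n) b i <= M) -> cvgn (series b).
Proof.
move=> b0 bM; apply: nondecreasing_is_cvgn.
  by apply/nondecreasing_seqP => n; rewrite /series/= big_nat_recr//= lerDl.
by exists M => _ [n _ <-]; rewrite /series/= big_mkord.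
Qed.

(** A block of the series has squared norm at most the block of squares, so the partial sums are
    Cauchy and completeness gives the limit. *)
Lemma riesz_fischer (a : nat -> R) M : (forall n, \sum_(i < n) a i ^+ 2 <= M) ->
  exists y : V, (fun n => \sum_(i < n) a i *: ee i) @ \oo --> y.
Proof.
move=> aM.
have cv : cvgn (series (fun i => a i *: ee i)).
  apply/cauchy_cvgP/cauchy_seriesP => eps eps0.
  have := @ler_psum_cvg (fun i => a i ^+ 2) M (fun=> sqr_ge0 _) aM.
  move/cauchy_cvgP/cauchy_seriesP => /(_ (eps ^+ 2) (exprn_gt0 _ eps0)).
  apply: filterS => -[m n]/= h.
  rewrite -ltr_sqr ?nnegrE ?(ltW eps0)//.
  by rewrite (le_lt_trans (psum_norm _ _ _))// (le_lt_trans (ler_norm _)).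
exists (limn (series (fun i => a i *: ee i))).
suff -> : (fun n => \sum_(i < n) a i *: ee i) = series (fun i => a i *: ee i) by [].
by apply/funext => n; rewrite /series/= big_mkord.
Qed.

Hypothesis total : forall x, (forall k, ip x (ee k) = 0) -> x = 0.

Lemma riesz_fischer_coef (a : nat -> R) y k :
  (fun n => \sum_(i < n) a i *: ee i) @ \oo --> y ->
  ip y (ee k) = a k * ip (ee k) (ee k).
Proof.
move=> ay; have c := cvg_ipl (z := ee k) ay.
rewrite -(cvg_lim (@Rhausdorff R) c); apply: cvg_lim => //.
apply: cvg_near_cst.
by exists k.+1 => // n /= kn; rewrite ip_psum kn.
Qed.

Lemma fourier_expansion x : (fun n => \sum_(i < n) ip x (ee i) *: ee i) @ \oo --> x.
Proof.
have [y xy] := @riesz_fischer (fun i => ip x (ee i)) _ (bessel x).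
suff e : y = x by rewrite e in xy.
apply/eqP; rewrite -subr_eq0; apply/eqP/total => k.
by rewrite ipBl (@riesz_fischer_coef (fun i => ip x (ee i)) y k xy) coef_unit subrr.
Qed.

Lemma parseval x y : (fun n => \sum_(i < n) ip x (ee i) * ip y (ee i)) @ \oo --> ip x y.
Proof.
have := cvg_ipl (z := y) (@fourier_expansion x).
suff -> : (fun n => ip (\sum_(i < n) ip x (ee i) *: ee i) y) =
  (fun n => \sum_(i < n) ip x (ee i) * ip y (ee i)) by [].
by apply/funext => n; rewrite (ip_psum2 (fun k => ip x (ee k))).
Qed.

End OrthoSequence.

End InnerProduct.

(** * Diagonal operators and Hilbert-Schmidt bounds in an orthonormal basis *)

Section Eigenbasis.
Context {R : realType} {V : completeNormedModType R} (ip : V -> V -> R).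
Hypothesis hip : inner_product ip.
Context {I : countType} (e : I -> V).
Hypothesis orth : forall i j, ip (e i) (e j) = (i == j)%:R.
Hypothesis total : forall x, (forall i, ip x (e i) = 0) -> x = 0.

(** [pickle_inv] is [None] off the image of [pickle], so every [e i] occurs exactly once and all
    other terms are 0; repetitions would destroy orthogonality. *)
Let ee (k : nat) : V := oapp e 0 (pickle_inv k).

Let eeP i : ee (pickle i) = e i.
Proof. by rewrite /ee pickleK_inv. Qed.

Let ee_orth k l : k != l -> ip (ee k) (ee l) = 0.
Proof.
rewrite /ee => kl.
case ek : (pickle_inv k) => [i|]/=; last by rewrite (ip0l hip).
case el : (pickle_inv l) => [j|]/=; last by rewrite (ip0r hip).
rewrite orth; case: eqP => // ij; move: kl.
have := @pickle_invK I k; have := @pickle_invK I l; rewrite ek el/= => <- <-.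
by rewrite ij eqxx.
Qed.

Let norm_e i : `|e i| = 1.
Proof.
by apply/eqP; rewrite -sqrp_eq1 ?normr_ge0// -(ip_norm hip) orth eqxx.
Qed.

Let ee_unit k : ee k = 0 \/ `|ee k| = 1.
Proof.
by rewrite /ee; case: pickle_inv => [i|]/=; [right; exact: norm_e|left].
Qed.

Let ee_total x : (forall k, ip x (ee k) = 0) -> x = 0.
Proof. by move=> h; apply: total => i; rewrite -eeP. Qed.

Lemma eigenvector_neq0 i : e i != 0.
Proof. by rewrite -normr_gt0 norm_e. Qed.

(** By Parseval both sides are limits of the same partial sums. This is how a diagonal operator is
    moved from one argument of [ip] to the other. *)
Lemma parseval_eq x y x' y' :
  (forall i, ip x (e i) * ip y (e i) = ip x' (e i) * ip y' (e i)) ->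
  ip x y = ip x' y'.
Proof.
move=> h; have p1 := parseval hip ee_orth ee_unit ee_total (x := x) (y := y).
have p2 := parseval hip ee_orth ee_unit ee_total (x := x') (y := y').
rewrite -(cvg_lim (@Rhausdorff R) p1); apply: cvg_lim => //.
suff -> : (fun n => \sum_(i < n) ip x (ee i) * ip y (ee i)) =
  (fun n => \sum_(i < n) ip x' (ee i) * ip y' (ee i)) by [].
apply/funext => n; apply: eq_bigr => k _; rewrite /ee.
by case: pickle_inv => [i|]/=; rewrite ?(ip0r hip) ?mul0r.
Qed.

(** The diagonal operator with bounded symbol [m]: the coefficients m_i x_i are square summable by
    Bessel, so Riesz-Fischer sums them. *)
Lemma multiplier (m : I -> R) C x : 0 <= C -> (forall i, `|m i| <= C) ->
  exists y, (forall i, ip y (e i) = m i * ip x (e i)) /\ `|y| <= C * `|x|.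
Proof.
move=> C0 mC; pose a (k : nat) := oapp m 0 (pickle_inv k) * ip x (ee k).
have aC n : \sum_(i < n) a i ^+ 2 <= (C * `|x|) ^+ 2.
  rewrite exprMn (le_trans _ (ler_wpM2l (sqr_ge0 C) (bessel hip ee_orth ee_unit x n)))//.
  rewrite mulr_sumr; apply: ler_sum => k _; rewrite exprMn ler_wpM2r ?sqr_ge0//.
  rewrite -[X in X <= _]real_normK ?num_real// ler_sqr ?nnegrE//; case: pickle_inv => [i|]/=; rewrite ?normr0//; exact: mC.
have [y hy] := riesz_fischer hip ee_orth ee_unit aC.
exists y; split=> [i|].
  rewrite -(eeP i) (riesz_fischer_coef hip ee_orth _ hy) /a pickleK_inv/=.
  by rewrite -mulrA (coef_unit hip ee_unit).
have yy : ip y y <= (C * `|x|) ^+ 2.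
  have hyy := cvg_ip hip hy hy.
  apply: (cvgr_to_le hyy); apply: nearW => n.
  rewrite (ip_norm hip) -(big_mkord xpredT (fun k => a k *: ee k)).
  by rewrite (le_trans (psum_norm hip ee_orth ee_unit _ _ _))// big_mkord.
rewrite -ler_sqr ?nnegrE ?mulr_ge0//.
by rewrite -(ip_norm hip).
Qed.

Lemma functional_eq0 (f : V -> R) C x :
  (forall a y z, f (a *: y + z) = a * f y + f z) ->
  (forall y, `|f y| <= C * `|y|) -> (forall i, f (e i) = 0) -> f x = 0.
Proof.
move=> flin fC fe; have f0 : f 0 = 0.
  by have := flin (-1) 0 0; rewrite scaler0 addr0 mulN1r addNr.
have hx := fourier_expansion hip ee_orth ee_unit ee_total (x := x).
have fs n : f (\sum_(i < n) ip x (ee i) *: ee i) = 0.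
  elim: n => [|n IH]; first by rewrite big_ord0.
  rewrite big_ord_recr/= addrC flin IH addr0 /ee.
  by case: pickle_inv => [i|]/=; rewrite ?fe ?f0 mulr0.
apply/normr0_eq0/le_anti; rewrite normr_ge0 andbT.
apply/ler_addgt0Pr => eps eps0; rewrite add0r.
(* [C] has no assumed sign; [|C| + 1] dominates it and can be divided by. *)
have C0 : 0 < `|C| + 1 by rewrite ltr_wpDl.
have /cvgrPdist_le/(_ (eps / (`|C| + 1)) (divr_gt0 eps0 C0)) := hx.
case=> n _ /(_ n (leqnn n)) /= hn.
have -> : f x = f (x - \sum_(i < n) ip x (ee i) *: ee i).
  by rewrite addrC -scaleN1r flin fs mulr0 add0r.
apply: le_trans (fC _) _; rewrite ler_pdivlMr// mulrC in hn.
apply: le_trans hn; apply: ler_wpM2r => //.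
by rewrite (le_trans (ler_norm C))// lerDl.
Qed.

Lemma sum_cauchy_schwarz (a b : nat -> R) n :
  (\sum_(i < n) a i * b i) ^+ 2 <= (\sum_(i < n) a i ^+ 2) * (\sum_(i < n) b i ^+ 2).
Proof.
elim: n => [|n IH]; first by rewrite !big_ord0 mul0r expr0n.
rewrite !big_ord_recr/=.
set s := \sum_(i < n) _ in IH *; set P := \sum_(i < n) _ in IH *.
set Q := \sum_(i < n) _ in IH *.
have P0 : 0 <= P by apply: sumr_ge0 => i _; exact: sqr_ge0.
have Q0 : 0 <= Q by apply: sumr_ge0 => i _; exact: sqr_ge0.
(* The cross term of the induction step: s^2 <= P Q by induction, and the arithmetic-geometric mean
   inequality gives the rest after squaring. *)
suff : 2 * (s * (a n * b n)) <= P * b n ^+ 2 + Q * a n ^+ 2.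
  move: IH; rewrite !expr2; set A := a n; set B := b n => IH h.
  by nra.
apply: le_trans (ler_norm _) _.
rewrite -ler_sqr ?nnegrE ?addr_ge0 ?(mulr_ge0 P0) ?(mulr_ge0 Q0) ?sqr_ge0//.
rewrite real_normK ?num_real//.
have h1 : 4 * (P * b n ^+ 2) * (Q * a n ^+ 2) <= (P * b n ^+ 2 + Q * a n ^+ 2) ^+ 2.
  rewrite -subr_ge0 (_ : _ - _ = (P * b n ^+ 2 - Q * a n ^+ 2) ^+ 2) ?sqr_ge0//.
  by ring.
apply: le_trans h1; rewrite (_ : (2 * _) ^+ 2 = 4 * (a n * b n) ^+ 2 * s ^+ 2); last by ring.
rewrite (_ : _ * (Q * _) = 4 * (a n * b n) ^+ 2 * (P * Q)); last by ring.
by rewrite ler_wpM2l// mulr_ge0// sqr_ge0.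
Qed.

Lemma hs_sum_le B n : B 0 = 0 -> (hs_sqnorm e B < +oo)%E ->
  \sum_(k < n) `|B (ee k)| ^+ 2 <= fine (hs_sqnorm e B).
Proof.
move=> B0 Boo; have h0 : (0 <= hs_sqnorm e B)%E.
  by apply: esum_ge0 => i _; rewrite lee_fin sqr_ge0.
rewrite -lee_fin fineK ?ge0_fin_numE//.
(* The indices met among the first n numbers form a duplicate-free finite set, hence one of the sums
   below [esum]; padding terms contribute [B 0 = 0]. *)
apply: esum_ge; exists [set` pmap (@pickle_inv I) (iota 0 n)].
  by split=> //; exact: finite_seq.
rewrite -fsbig_seq; last first.
  by rewrite (pmap_uniq (@pickle_invK I))// iota_uniq.
rewrite -(big_mkord xpredT (fun k => `|B (ee k)| ^+ 2)) -sumEFin big_pmap/=.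
rewrite /index_iota subn0.
apply: lee_sum => k _; rewrite /ee; case: pickle_inv => [i|]//=.
by rewrite B0 normr0 expr0n.
Qed.

(** Continuity carries the Fourier expansion of [v] through [B]; on partial sums Cauchy-Schwarz
    separates the coefficients, bounded by Bessel, from the values on the basis. *)
Lemma hs_bound B v : hilbert_schmidt e B -> `|B v| <= hs_norm e B * `|v|.
Proof.
case=> Blin Bcont Boo.
have B0 : B 0 = 0 by have := Blin (-1) 0 0; rewrite !scaleN1r oppr0 addr0 addNr.
have Bsum (a : nat -> R) n : B (\sum_(i < n) a i *: ee i) = \sum_(i < n) a i *: B (ee i).
  elim: n => [|n IH]; first by rewrite !big_ord0.
  by rewrite !big_ord_recr/= addrC Blin IH addrC.
have hv := fourier_expansion hip ee_orth ee_unit ee_total (x := v).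
have hBv : B (\sum_(i < n) ip v (ee i) *: ee i) @[n --> \oo] --> B v.
  by apply: continuous_cvg => //; exact: Bcont.
apply: (cvgr_to_le (cvg_norm hBv)); apply: nearW => n.
rewrite (Bsum (fun i => ip v (ee i))).
rewrite -ler_sqr ?nnegrE ?mulr_ge0 ?sqrtr_ge0// exprMn sqr_sqrtr; last first.
  by rewrite fine_ge0// esum_ge0// => i _; rewrite lee_fin sqr_ge0.
apply: le_trans (_ : (\sum_(i < n) `|ip v (ee i)| * `|B (ee i)|) ^+ 2 <= _).
  rewrite ler_sqr ?nnegrE//; last by apply: sumr_ge0 => i _; rewrite mulr_ge0.
  by rewrite (le_trans (ler_norm_sum _ _ _))// ler_sum// => i _; rewrite normrZ.
rewrite (le_trans (@sum_cauchy_schwarz (fun i => `|ip v (ee i)|) (fun i => `|B (ee i)|) n))//.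
rewrite mulrC ler_pM ?sumr_ge0//; try by move=> i _; exact: sqr_ge0.
  exact: hs_sum_le.
apply: le_trans (bessel hip ee_orth ee_unit v n).
by apply: ler_sum => i _; rewrite real_normK ?num_real.
Qed.
End Eigenbasis.

(** * Scalar bounds for exponentials against powers *)

Section ExpBounds.
Context {R : realType}.
Implicit Types x y p l t h g d b : R.

Lemma expRN_sub1D_le y : 0 <= y -> `|expR (- y) - 1 + y| <= y ^+ 2.
Proof.
move=> y0; have h1 := expR_ge1Dx (- y); have h2 := expR_ge1Dx y.
rewrite ger0_norm; last by lra.
have E : expR (- y) * (1 + y) <= 1.
  by rewrite expRN ler_pdivrMl ?expR_gt0// mulr1.
have := expR_gt0 (- y); set u := expR (- y) in E *; rewrite expr2; nra.
Qed.

(** The left side is at most min(1, y), and that is at most y^p for p in [0, 1]. *)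
Lemma one_sub_expRN_le p y : 0 <= y -> 0 <= p <= 1 -> 1 - expR (- y) <= y `^ p.
Proof.
rewrite le_eqVlt => /predU1P[<- _|y0 /andP[p0 p1]].
  by rewrite oppr0 expR0 subrr powR_ge0.
have [y1|/ltW y1] := leP 1 y.
  apply: le_trans (_ : 1 <= _); first by rewrite gerBl expR_ge0.
  by rewrite -(powRr0 y) ler_powR.
apply: le_trans (_ : y <= _); last by rewrite ger1_powR// y0.
by have := expR_ge1Dx (- y); lra.
Qed.

(** Origin of the constant 4 in all smoothing estimates: y^2 <= 4 (1 + y/2)^2 <= 4 exp y. Exponents
    up to 2 occur as sums of a smoothing order and a time regularity, each at most 1. *)
Lemma powR_le_expR p y : 0 <= y -> 0 <= p <= 2 -> y `^ p <= 4 * expR y.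
Proof.
move=> y0 /andP[p0 p2].
have [y1|/ltW y1] := leP 1 y.
  apply: le_trans (_ : y `^ 2%:R <= _); first by rewrite ler_powR.
  rewrite powR_mulrn//; have := expR_ge1Dx (y / 2).
  have -> : expR y = expR (y / 2) * expR (y / 2) by rewrite -expRD; congr expR; lra.
  set u := expR _; rewrite expr2; nra.
apply: le_trans (_ : 1 <= _); last by have := expR_ge1Dx y; lra.
have <- : (1 : R) `^ p = 1 by rewrite (powR1 R).
by rewrite ge0_ler_powR// nnegrE.
Qed.

Lemma powRMexpRN_le l t d : 0 < l -> 0 < t -> 0 <= d <= 2 ->
  l `^ d * expR (- l * t) <= 4 * t `^ (- d).
Proof.
move=> l0 t0 d02.
have := powR_le_expR (y := l * t) (mulr_ge0 (ltW l0) (ltW t0)) d02.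
rewrite powRM ?(ltW l0) ?(ltW t0)// powRN mulNr expRN => h.
by rewrite ler_pdivrMr ?expR_gt0// mulrAC ler_pdivlMr ?powR_gt0.
Qed.

(** The factor 1 - exp(- l h) is at most (l h)^g; the power l^g it costs is absorbed, with l^d, by
    exp(- l t). *)
Lemma powR_diff_expRN_le l t h g d : 0 < l -> 0 < t -> 0 <= h ->
    0 <= g <= 1 -> 0 <= d <= 1 ->
  l `^ d * (expR (- l * t) - expR (- l * (t + h))) <= 4 * h `^ g * t `^ (- (g + d)).
Proof.
move=> l0 t0 h0 g01 d01.
have lh : 0 <= l * h by rewrite mulr_ge0 // ltW.
have := one_sub_expRN_le lh g01.
rewrite powRM ?(ltW l0)// -mulNr => h1.
have -> : expR (- l * (t + h)) = expR (- l * t) * expR (- l * h).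
  by rewrite -expRD mulrDr.
have gd : 0 <= g + d <= 2 by move: g01 d01; lra.
have h2 := powRMexpRN_le l0 t0 gd.
rewrite powRD ?(lt0r_neq0 l0) ?implybT// in h2.
have h3 : h `^ g * (l `^ g * l `^ d * expR (- l * t)) <= h `^ g * (4 * t `^ (- (g + d))).
  by rewrite ler_wpM2l ?powR_ge0.
rewrite (_ : 4 * _ * _ = h `^ g * (4 * t `^ (- (g + d)))); last by ring.
apply: le_trans h3.
have -> : h `^ g * (l `^ g * l `^ d * expR (- l * t)) =
  l `^ d * (expR (- l * t) * (l `^ g * h `^ g)) by ring.
rewrite ler_wpM2l ?powR_ge0//.
by rewrite -{1}(mulr1 (expR (- l * t))) -mulrBr ler_wpM2l ?expR_ge0.
Qed.

Lemma one_sub_expRN_powRN_le l h b : 0 < l -> 0 <= h -> 0 <= b <= 1 ->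
  (1 - expR (- l * h)) * l `^ (- b) <= h `^ b.
Proof.
move=> l0 h0 b01.
have lh : 0 <= l * h by rewrite mulr_ge0 // ltW.
have := one_sub_expRN_le lh b01.
rewrite powRM ?(ltW l0)// -mulNr => h1.
by rewrite powRN ler_pdivrMr ?powR_gt0// (mulrC (h `^ b)).
Qed.

End ExpBounds.

(** * The semigroup in the eigenbasis and its smoothing *)

Section Semigroup.
Context {R : realType} {V : completeNormedModType R} (ip : V -> V -> R).
Hypothesis hip : inner_product ip.
Context {I : countType} (e : I -> V) (lam : I -> R).
Context (DA : set V) (A : V -> V) (S : R -> V -> V).
Hypothesis heig : eigenbasis_opp ip DA A e lam.
Hypothesis hpos : strictly_positive_opp ip DA A.
Hypothesis hS : generates_semigroup DA A S.

Let orth := eigb_orth heig.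
Let total := eigb_total heig.

Lemma lam_gt0 i : 0 < lam i.
Proof.
have [De Ae] := eigb_eig heig i.
have := hpos De (eigenvector_neq0 hip orth i).
by rewrite Ae (ipZl hip) orth eqxx mulr1.
Qed.

Lemma semigroup_bounded : exists2 M : R, 0 <= M & forall t x, 0 <= t -> `|S t x| <= M * `|x|.
Proof.
have [M [k [k0 h]]] := sg_decay hS; exists `|M| => // t x t0.
apply: le_trans (h t x t0) _; rewrite ler_wpM2r//.
apply: le_trans (_ : `|M| * expR (- k * t) <= _).
  by rewrite ler_wpM2r ?expR_ge0 ?ler_norm.
by rewrite ler_piMr// expR_le1// mulNr oppr_le0 mulr_ge0// ltW.
Qed.

(* [S t] is the n-th power of [S (t / n)], which agrees with the scalar
   [exp (- lam i t / n)] on [e i] up to [o(t / n)]. *)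
Lemma semigroup_eigenvector t i : 0 <= t -> S t (e i) = expR (- lam i * t) *: e i.
Proof.
rewrite le_eqVlt => /predU1P[<-|t0].
  by rewrite mulr0 expR0 scale1r (sg_zero hS).
have [De Ae] := eigb_eig heig i.
have l0 := lam_gt0 i; set l := lam i in Ae l0 *; set x := e i in De Ae *.
have ne : `|x| = 1.
  by apply/eqP; rewrite -sqrp_eq1 ?normr_ge0// -(ip_norm hip) orth eqxx.
have [M M0 hM] := semigroup_bounded.
have small eps : 0 < eps -> \forall h \near (0 : R)^'+,
    `|S h x - expR (- l * h) *: x| <= eps * h.
  move=> eps0; have [+ _] := sg_generator hS x (A x).
  move=> /(_ (conj De erefl)) /cvgrPdist_le /(_ (eps / 2)).
  rewrite divr_gt0// => /(_ isT) hgen.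
  near=> h.
  have h0 : 0 < h by near: h; exact: nbhs_right_gt.
  have -> : S h x - expR (- l * h) *: x =
     - h *: (A x - h^-1 *: (S h x - x)) - (expR (- (l * h)) - 1 + l * h) *: x.
    have -> : A x = - l *: x by rewrite scaleNr -Ae opprK.
    apply: (ip_inj hip) => z.
    rewrite !(ipDl hip, ipZl hip, ipNl hip) (mulNr l h); field.
    by rewrite gt_eqF.
  have h1 : `|A x - h^-1 *: (S h x - x)| <= eps / 2 by near: h.
  have h2 := expRN_sub1D_le (mulr_ge0 (ltW l0) (ltW h0)).
  have h3 : (l * h) ^+ 2 <= eps / 2 * h.
    have : h <= eps / 2 / l ^+ 2.
      by near: h; apply: nbhs_right_le; rewrite !divr_gt0// exprn_gt0.
    rewrite ler_pdivlMr ?exprn_gt0// exprMn => h3.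
    by rewrite [X in _ * X]expr2 mulrA ler_wpM2r ?(ltW h0)// mulrC.
  rewrite (le_trans (ler_normB _ _))// !normrZ ne mulr1 normrN (gtr0_norm h0).
  rewrite (_ : eps * h = h * (eps / 2) + eps / 2 * h); last by lra.
  by rewrite lerD ?ler_wpM2l ?(ltW h0)// (le_trans h2).
apply/eqP; rewrite -subr_eq0 -normr_le0; apply/ler_addgt0Pr => eps eps0.
rewrite add0r.
have Mt : 0 < (M + 1) * t by rewrite mulr_gt0// ltr_wpDl.
have [d /= d0 hd] := small _ (divr_gt0 eps0 Mt).
have [n nt] : exists n : nat, t / n.+1%:R < d.
  exists (Num.trunc (t / d)); rewrite ltr_pdivrMr// mulrC -ltr_pdivrMr//.
  by rewrite truncnS_gt.
set h := t / n.+1%:R in nt.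
have h0 : 0 < h by rewrite divr_gt0.
have hh : `|S h x - expR (- l * h) *: x| <= eps / ((M + 1) * t) * h.
  by apply: hd => //=; rewrite sub0r normrN gtr0_norm.
(* Passing from m to m + 1 adds a local error amplified by at most M, while the accumulated error is
   multiplied by a scalar at most 1. Over n + 1 steps this adds up to at most eps. *)
have step m : `|S (m%:R * h) x - expR (- l * (m%:R * h)) *: x| <=
    m%:R * (M + 1) * (eps / ((M + 1) * t) * h).
  elim: m => [|m IH].
    by rewrite !mul0r (sg_zero hS) mulr0 expR0 scale1r subrr normr0.
  have mh : 0 <= m%:R * h by rewrite mulr_ge0// ltW.
  have -> : m.+1%:R * h = m%:R * h + h by rewrite -natr1 mulrDl mul1r.
  have -> : S (m%:R * h + h) x - expR (- l * (m%:R * h + h)) *: x =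
     S (m%:R * h) (S h x - expR (- l * h) *: x) +
     expR (- l * h) *: (S (m%:R * h) x - expR (- l * (m%:R * h)) *: x).
    have E : S (m%:R * h) (S h x - expR (- l * h) *: x) =
      S (m%:R * h + h) x - expR (- l * h) *: S (m%:R * h) x.
      rewrite -scaleNr addrC (sg_linear hS mh) addrC scaleNr.
      by rewrite (sg_add hS)// ltW.
    rewrite E mulrDr expRD.
    by apply: (ip_inj hip) => z; rewrite !(ipDl hip, ipZl hip, ipNl hip); ring.
  rewrite (le_trans (ler_normD _ _))//.
  rewrite (_ : m.+1%:R * _ * _ = (M + 1) * (eps / ((M + 1) * t) * h) +
    m%:R * (M + 1) * (eps / ((M + 1) * t) * h)); last by rewrite -natr1; ring.
  apply: lerD.
    apply: le_trans (hM _ _ mh) _.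
    by rewrite ler_pM// ?lerDl.
  rewrite normrZ ger0_norm ?expR_ge0// (le_trans _ IH)// ler_piMl//.
  by rewrite expR_le1 mulNr oppr_le0 mulr_ge0// ltW.
have E : n.+1%:R * h = t by rewrite /h mulrC divfK.
have := step n.+1; rewrite E => /le_trans; apply.
rewrite (_ : _ * _ = (n.+1%:R * h) * (eps / t)); last first.
  by field; rewrite !gt_eqF// ltr_wpDl.
by rewrite E mulrC divfK ?gt_eqF.
Unshelve. all: by end_near.
Qed.

(** The difference of the two sides is a bounded linear functional of [x] that vanishes on every
    eigenvector. *)
Lemma semigroup_coef t x i : 0 <= t -> ip (S t x) (e i) = expR (- lam i * t) * ip x (e i).
Proof.
move=> t0; apply/eqP; rewrite -subr_eq0; apply/eqP.
have [M M0 hM] := semigroup_bounded.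
have ne j : `|e j| = 1.
  by apply/eqP; rewrite -sqrp_eq1 ?normr_ge0// -(ip_norm hip) orth eqxx.
apply: (functional_eq0 hip orth total (C := M + expR (- lam i * t))
  (f := fun x => ip (S t x) (e i) - expR (- lam i * t) * ip x (e i))).
- move=> a y z; rewrite (sg_linear hS t0) !(ipDl hip) !(ipZl hip); ring.
- move=> y; rewrite (le_trans (ler_normB _ _))// mulrDl lerD//.
    by rewrite (le_trans (cauchy_schwarz hip _ _))// ne mulr1 hM.
  rewrite normrM (ger0_norm (expR_ge0 _)) ler_wpM2l ?expR_ge0//.
  by rewrite (le_trans (cauchy_schwarz hip _ _))// ne mulr1.
- move=> j; rewrite semigroup_eigenvector// (ipZl hip) orth.
  by have [->|] := eqVneq j i; rewrite ?subrr// !mulr0 subrr.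
Qed.

(* [Vle d x c] says that x lies in V_d with norm at most [c]; testing against
   the range of (-A)^d makes it stable under weak integrals. *)
Definition Vle (d : R) (x : V) (c : R) : Prop :=
  forall v y, frac_power_graph ip e lam d v y -> `|ip x y| <= c * `|v|.

Lemma Vle_le d x c c' : c <= c' -> Vle d x c -> Vle d x c'.
Proof.
by move=> cc' h v y vy; apply: le_trans (h v y vy) _; rewrite ler_wpM2r.
Qed.

Lemma Vle_add d x x' c c' : Vle d x c -> Vle d x' c' -> Vle d (x + x') (c + c').
Proof.
move=> h h' v y vy; rewrite (ipDl hip) (le_trans (ler_normD _ _))// mulrDl.
by rewrite lerD// ?h// h'.
Qed.

Lemma Vle_scale d x c a : Vle d x c -> Vle d (a *: x) (`|a| * c).
Proof.
by move=> h v y vy; rewrite (ipZl hip) normrM -mulrA ler_wpM2l// h.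
Qed.

Lemma Vle_opp d x c : Vle d x c -> Vle d (- x) c.
Proof. by move=> h v y vy; rewrite (ipNl hip) normrN h. Qed.

Lemma Vle_zero d c : 0 <= c -> Vle d 0 c.
Proof. by move=> c0 v y _; rewrite (ip0l hip) normr0 mulr_ge0. Qed.

Lemma Vle0_norm x c : 0 <= c -> Vle 0 x c -> `|x| <= c.
Proof.
move=> c0 h; apply: (norm_le_ip hip c0) => z; apply: h => i.
by rewrite powRr0 mul1r.
Qed.

Lemma norm_Vle0 x c : `|x| <= c -> Vle 0 x c.
Proof.
move=> xc v y vy.
have -> : y = v.
  apply/eqP; rewrite -subr_eq0; apply/eqP/total => i.
  by rewrite (ipBl hip) vy powRr0 mul1r subrr.
by rewrite (le_trans (cauchy_schwarz hip _ _))// ler_wpM2r.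
Qed.

(** The symbol lam^d m is bounded by [C], so it acts on the test vector [v] instead: the pairing of
    x' with (-A)^d v equals that of [x] with a vector of norm at most C |v|. *)
Lemma Vle_multiplier d (m : I -> R) C x x' : 0 <= C ->
  (forall i, `|lam i `^ d * m i| <= C) ->
  (forall i, ip x' (e i) = m i * ip x (e i)) -> Vle d x' (C * `|x|).
Proof.
move=> C0 mC hx v y vy.
have [z [hz zv]] := multiplier hip orth v C0 mC.
have -> : ip x' y = ip x z.
  by apply: (parseval_eq hip orth total) => i; rewrite hx vy hz; ring.
rewrite (le_trans (cauchy_schwarz hip _ _))// mulrC mulrAC.
by rewrite ler_wpM2r.
Qed.

Lemma semigroup_smoothing d t x : 0 < t -> 0 <= d <= 1 ->
  Vle d (S t x) (4 * t `^ (- d) * `|x|).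
Proof.
move=> t0 /andP[d0 d1].
apply: Vle_multiplier (fun i => semigroup_coef x i (ltW t0)).
  by rewrite mulr_ge0 ?powR_ge0.
move=> i; rewrite ger0_norm ?mulr_ge0 ?powR_ge0 ?expR_ge0//.
by apply: powRMexpRN_le => //; [exact: lam_gt0|lra].
Qed.

Lemma semigroup_smoothing_diff d g t h x : 0 < t -> 0 <= h ->
    0 <= d <= 1 -> 0 <= g <= 1 ->
  Vle d (S t x - S (t + h) x) (4 * h `^ g * t `^ (- (g + d)) * `|x|).
Proof.
move=> t0 h0 d01 g01.
apply: (@Vle_multiplier _ (fun i => expR (- lam i * t) - expR (- lam i * (t + h)))).
- by rewrite !mulr_ge0 ?powR_ge0.
- move=> i; have l0 := lam_gt0 i; rewrite ger0_norm; last first.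
    rewrite mulr_ge0 ?powR_ge0// subr_ge0 ler_expR !mulNr lerN2 ler_pM2l//.
    by rewrite lerDl.
  exact: powR_diff_expRN_le.
- move=> i; rewrite (ipBl hip) !semigroup_coef ?addr_ge0 ?(ltW t0)//.
  by rewrite mulrBl.
Qed.

(** Moved to the test side, S h - 1 produces y = (1 - S h) z, which is (-A)^b of a vector of norm at
    most h^b |z|; on that vector the assumption on [x] can be tested. *)
Lemma semigroup_sub_id b h x c : 0 <= h -> 0 <= b <= 1 -> 0 <= c ->
  Vle b x c -> `|S h x - x| <= h `^ b * c.
Proof.
move=> h0 b01 c0 hx; apply: (norm_le_ip hip) => [|z].
  by rewrite mulr_ge0 ?powR_ge0.
have lb i : 0 <= 1 - expR (- lam i * h) <= 1.
  have l0 := lam_gt0 i; rewrite subr_ge0 expR_le1 gerBl expR_ge0 andbT.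
  by rewrite mulNr oppr_le0 mulr_ge0// ltW.
have [v [hv vz]] : exists v, (forall i, ip v (e i) =
    ((1 - expR (- lam i * h)) * lam i `^ (- b)) * ip z (e i)) /\ `|v| <= h `^ b * `|z|.
  apply: (multiplier hip orth); rewrite ?powR_ge0// => i.
  have /andP[l0 _] := lb i.
  by rewrite ger0_norm ?mulr_ge0 ?powR_ge0// one_sub_expRN_powRN_le// lam_gt0.
have [y [hy _]] : exists y, (forall i, ip y (e i) =
    (1 - expR (- lam i * h)) * ip z (e i)) /\ `|y| <= 1 * `|z|.
  apply: (multiplier hip orth) => // i.
  by have /andP[l0 l1] := lb i; rewrite ger0_norm.
have -> : ip (S h x - x) z = - ip x y.
  rewrite -(ipNl hip); apply: (parseval_eq hip orth total) => i.
  by rewrite (ipBl hip) (ipNl hip) semigroup_coef// hy; ring.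
rewrite normrN; apply: le_trans (hx v y _) _ => [i|].
  rewrite hy hv mulrA; congr (_ * _); rewrite mulrCA -powRD.
    by rewrite subrr powRr0 mulr1.
  by rewrite (lt0r_neq0 (lam_gt0 i)) implybT.
by rewrite mulrC (mulrAC _ c) mulrC [leRHS]mulrC ler_wpM2l.
Qed.

End Semigroup.

(** * Lipschitz and growth bounds for the nonlinearity *)

Section Nonlinearity.
Context {R : realType} {V : completeNormedModType R} (ip : V -> V -> R).
Hypothesis hip : inner_product ip.
Context {I : countType} (e : I -> V).
Hypothesis orth : forall i j, ip (e i) (e j) = (i == j)%:R.
Hypothesis total : forall x, (forall i, ip x (e i) = 0) -> x = 0.

Lemma hilbert_schmidtB (B C : V -> V) :
  hilbert_schmidt e B -> hilbert_schmidt e C -> hilbert_schmidt e (B - C).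
Proof.
move=> [lB cB hB] [lC cC hC]; split.
- move=> a x y; rewrite !fctE lB lC; apply: (ip_inj hip) => z.
  by rewrite !(ipDl hip, ipZl hip, ipNl hip); ring.
- by move=> x; apply: cvgB; [exact: cB|exact: cC].
have nn (D : V -> V) i : (0 <= (`|D (e i)| ^+ 2)%:E)%E by rewrite lee_fin sqr_ge0.
have hD (D : V -> V) : (hs_sqnorm e D < +oo)%E ->
    (\esum_(i in [set: I]) ((`|D (e i)| ^+ 2)%:E + (`|D (e i)| ^+ 2)%:E) < +oo)%E.
  by move=> h; rewrite esumD// lte_add_pinfty.
apply: le_lt_trans (lte_add_pinfty (hD _ hB) (hD _ hC)).
rewrite -esumD => [|i _|i _]; rewrite ?adde_ge0 ?nn//.
apply: le_esum => i _; rewrite -!EFinD lee_fin !fctE.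
apply: le_trans (_ : (`|B (e i)| + `|C (e i)|) ^+ 2 <= _).
  by rewrite ler_sqr ?nnegrE ?addr_ge0// ler_normB.
by set a := `|_|; set b := `|_|; have := sqr_ge0 (a - b); rewrite !expr2; nra.
Qed.

Context (G : V -> V -> V) (DG : V -> V -> V -> V) (D2G : V -> V -> V -> V -> V).
Hypothesis hG : C2_bounded_derivatives e G DG D2G.

Let g (x h v z : V) (s : R) : R := ip (G (x + s *: h) v) z.

Let is_derive_g (x h v z : V) (s : R) : is_derive s (1 : R) (g x h v z) (ip (DG (x + s *: h) h v) z).
Proof.
set y := x + s *: h.
suff H : (fun r => r^-1 *: ((g x h v z \o shift s) (r *: (1 : R)) - g x h v z s) : R) @ (0 : R)^' --> ip (DG y h v) z.
  by apply: DeriveDef; [apply/cvg_ex; exists (ip (DG y h v) z)|exact: cvg_lim].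
apply/cvgrPdist_le => eps eps0.
(* The added 1 keeps [C] positive when one of the three vectors is 0. *)
pose C := `|h| * `|v| * `|z| + 1.
have C0 : 0 < C by rewrite ltr_wpDl ?mulr_ge0.
have hd := DG_deriv hG y (divr_gt0 eps0 C0).
have hd' : \forall r \near (0 : R), hs_norm e (G (y + r *: h) - G y - DG y (r *: h)) <= eps / C * `|r *: h|.
  have c : (fun r : R => r *: h) @ (0 : R) --> (0 : V).
    by rewrite -[X in _ --> X](scale0r h); apply: cvgZl; exact: cvg_id.
  exact: (c _ hd).
near=> r.
have r0 : r != 0 by near: r; exact: nbhs_dnbhs_neq.
have hr : hs_norm e (G (y + r *: h) - G y - DG y (r *: h)) <= eps / C * `|r *: h|.
  by near: r; exact: nbhs_dnbhs.
have hsr : hilbert_schmidt e (G (y + r *: h) - G y - DG y (r *: h)).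
  by apply: hilbert_schmidtB; [apply: hilbert_schmidtB; exact: G_hs hG _|exact: DG_hs hG _ _].
have := hs_bound hip orth total v hsr; rewrite !fctE.
have -> : DG y (r *: h) v = r *: DG y h v.
  have := DG_lin hG y r h 0; rewrite addr0 => ->.
  have -> : DG y 0 = 0.
    by have := DG_lin hG y (-1) 0 0; rewrite scaler0 addr0 scaleN1r addNr.
  by rewrite fctE addr0.
move=> hb.
have -> : ip (DG y h v) z - r^-1 *: ((g x h v z \o shift s) (r *: 1) - g x h v z s) =
  - r^-1 * ip (G (y + r *: h) v - G y v - r *: DG y h v) z.
  rewrite /g/= /shift !(ipDl hip, ipZl hip, ipNl hip).
  rewrite (_ : x + (r *: 1 + s) *: h = y + r *: h); last first.
    rewrite /y scalerDl -[r *: 1]/(r * 1) mulr1.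
    by rewrite (addrC (r *: h)) addrA.
  by rewrite /GRing.scale/=; field.
rewrite normrM normrN normfV ler_pdivrMl ?normr_gt0//.
rewrite (le_trans (cauchy_schwarz hip _ _))//.
apply: le_trans (_ : eps / C * `|r *: h| * `|v| * `|z| <= _).
  by rewrite ler_wpM2r// (le_trans hb)// ler_wpM2r.
rewrite normrZ [leLHS](_ : _ = `|r| * (eps / C * (`|h| * `|v| * `|z|))); last by ring.
rewrite ler_wpM2l// mulrAC ler_pdivrMr// ler_wpM2l ?(ltW eps0)//.
by rewrite lerDl.
Unshelve. all: by end_near.
Qed.

(** After pairing with [z], the real mean value theorem applies along the segment from x to y; the
    bound on DG enters through the operator norm, which is below the Hilbert-Schmidt norm. *)
Lemma lipschitz_nonlinearity : exists2 M : R, 0 <= M &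
  forall x y v, `|G y v - G x v| <= M * `|y - x| * `|v|.
Proof.
have [M hM] := DG_bounded hG.
exists `|M| => // x y v; set h := y - x.
apply: (norm_le_ip hip) => [|z]; first by rewrite !mulr_ge0.
have [||c _] := @MVT_segment R (g x h v z) (fun s => ip (DG (x + s *: h) h v) z) 0 1 ler01.
- by move=> s _; exact: is_derive_g.
- by apply: derivable_within_continuous => s _; apply: ex_derive; exact: is_derive_g.
have xh : x + h = y by rewrite /h addrC subrK.
rewrite /g subr0 mulr1 scale1r scale0r addr0 xh.
rewrite -(ipBl hip) => ->.
rewrite (le_trans (cauchy_schwarz hip _ _))// ler_wpM2r//.
rewrite (le_trans (hs_bound hip orth total v (DG_hs hG _ _)))// ler_wpM2r//.
by rewrite (le_trans (hM _ _))// ler_wpM2r// ler_norm.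
Qed.

Lemma linear_growth_nonlinearity : exists2 M : R, 0 <= M &
  forall x v, `|G x v| <= M * (1 + `|x|) * `|v|.
Proof.
have [M M0 hM] := lipschitz_nonlinearity.
exists (M + hs_norm e (G 0)) => [|x v].
  by rewrite addr_ge0// sqrtr_ge0.
have := hM 0 x v; rewrite subr0 => h1.
have h2 := hs_bound hip orth total v (G_hs hG 0).
have h3 : 0 <= hs_norm e (G 0) by exact: sqrtr_ge0.
rewrite -(subrK (G 0 v) (G x v)) (le_trans (ler_normD _ _))//.
apply: le_trans (lerD h1 h2) _.
rewrite -mulrDl ler_wpM2r//.
by have := normr_ge0 x; nra.
Qed.

End Nonlinearity.

(** * Integrals of power singularities *)

Section PowerIntegrals.
Context {R : realType}.
Implicit Types (a b p q L : R) (f F : R -> R).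

(** An improper integral: [f] may blow up at both ends, so the fundamental theorem is applied on
    compact subintervals that exhaust ]a, b[, followed by monotone convergence. *)
Lemma integral_le_primitive a b L f F :
  {in `]a, b[, continuous f} ->
  (forall x, x \in `]a, b[ -> is_derive x (1 : R) F (f x)) ->
  {in `]a, b[, forall x, 0 <= f x} -> 0 <= L ->
  (forall x y, a < x -> x < y -> y < b -> F y - F x <= L) ->
  (\int[lebesgue_measure]_(x in `]a, b[) (f x)%:E <= L%:E)%E.
Proof.
move=> fc Ff f0 L0 FL.
pose D (n : nat) : set R := `[a + n.+1%:R^-1, b - n.+1%:R^-1]%classic.
have subD n : D n `<=` `]a, b[%classic.
  move=> x; rewrite /D /= !in_itv/= => /andP[h1 h2].
  have := @invr_gt0 R n.+1%:R; rewrite ltr0Sn; move: h1 h2.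
  by set r := n.+1%:R^-1 => h1 h2 r0; apply/andP; split; lra.
have DE : `]a, b[%classic = \bigcup_n D n.
  apply/seteqP; split=> [x /=|x [n _]]; last exact: subD.
  rewrite in_itv/= => /andP[ax xb].
  have m0 : 0 < Num.min (x - a) (b - x) by rewrite lt_min !subr_gt0 ax xb.
  exists (Num.trunc (Num.min (x - a) (b - x))^-1) => //.
  set n := Num.trunc _.
  have h : n.+1%:R^-1 <= Num.min (x - a) (b - x).
    by rewrite invf_ple ?posrE// ltW// truncnS_gt.
  move: h; rewrite le_min /D/= in_itv/=; set r := n.+1%:R^-1.
  by move=> /andP[h1 h2]; apply/andP; split; lra.
have Dmono : {homo D : n m / (n <= m)%N >-> (n <= m)%O}.
  move=> n m nm; rewrite subsetEset /D => x/=; rewrite !in_itv/= => /andP[h1 h2].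
  have : m.+1%:R^-1 <= n.+1%:R^-1 :> R by rewrite lef_pV2 ?posrE// ler_nat.
  move: h1 h2; set r := n.+1%:R^-1; set r' := m.+1%:R^-1 => h1 h2 h.
  by apply/andP; split; lra.
have contD n : {within D n, continuous f}.
  apply: continuous_in_subspaceT => x; rewrite inE => /subD; exact: fc.
have cv : (\int[lebesgue_measure]_(x in D n) (f x)%:E)%E @[n --> \oo] -->
    (\int[lebesgue_measure]_(x in \bigcup_n D n) (f x)%:E)%E.
  apply: ge0_nondecreasing_set_cvg_integral => // [n|n|n x /subD xab].
  - exact: measurable_itv.
  - apply/measurable_EFinP; apply: subspace_continuous_measurable_fun; last exact: contD.
    exact: measurable_itv.
  - by rewrite /= lee_fin f0.
rewrite DE; apply: (cvge_to_le cv).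
apply: nearW => n; rewrite /D.
(* For small n the interval [D n] is empty or a single point. *)
have [lt|ge] := ltP (a + n.+1%:R^-1) (b - n.+1%:R^-1); last first.
  rewrite (@integral_Sset1 _ _ _ (a + n.+1%:R^-1)) ?lee_fin// => x /=.
  rewrite in_itv/= => /andP[h1 h2]; apply/eqP; rewrite eq_le h1 andbT.
  exact: le_trans ge.
have n0 : 0 < n.+1%:R^-1 :> R by rewrite invr_gt0.
have sub' x : x \in `]a + n.+1%:R^-1, b - n.+1%:R^-1[ -> x \in `]a, b[.
  rewrite !in_itv/= => /andP[h1 h2].
  by rewrite (lt_trans _ h1) ?ltrDl// (lt_trans h2)// gtrBl.
have cF x : x \in `[a + n.+1%:R^-1, b - n.+1%:R^-1] -> {for x, continuous F}.
  move=> /subD /Ff h; apply/differentiable_continuous/derivable1_diffP.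
  exact: ex_derive.
rewrite (continuous_FTC2 (F := F) lt (contD n)).
- by rewrite -EFinB lee_fin FL// ?ltrDl// gtrBl.
- split.
  + by move=> x /sub' /Ff h; exact: ex_derive.
  + by apply: cvg_at_right_filter; apply: cF; rewrite in_itv/= lexx ltW.
  + by apply: cvg_at_left_filter; apply: cF; rewrite in_itv/= lexx ltW.
- by move=> x /sub' /Ff h; rewrite derive1E derive_val.
Qed.

Lemma is_derive_powR_left a r x : a < x ->
  is_derive x (1 : R) (fun q => (q - a) `^ r) (r * (x - a) `^ (r - 1)).
Proof.
move=> ax.
have h1 : is_derive x (1 : R) (fun q => q - a) 1.
  by rewrite -[X in is_derive _ _ _ X]subr0; apply: is_deriveB.
have := is_derive1_powR r (x := x - a); rewrite subr_gt0 => /(_ ax) h2.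
by have := @is_derive1_comp R (@powR R ^~ r) (fun q => q - a) x _ _ h2 h1; rewrite mulr1.
Qed.

Lemma is_derive_powR_right b r x : x < b ->
  is_derive x (1 : R) (fun q => (b - q) `^ r) (- (r * (b - x) `^ (r - 1))).
Proof.
move=> xb.
have h1 : is_derive x (1 : R) (fun q => b - q) (-1).
  by rewrite -[X in is_derive _ _ _ X]add0r; apply: is_deriveB.
have := is_derive1_powR r (x := b - x); rewrite subr_gt0 => /(_ xb) h2.
by have := @is_derive1_comp R (@powR R ^~ r) (fun q => b - q) x _ _ h2 h1; rewrite mulrN1.
Qed.

Lemma is_derive_continuous f x df : is_derive x (1 : R) f df -> {for x, continuous f}.
Proof.
move=> h; apply/differentiable_continuous/derivable1_diffP; exact: ex_derive.
Qed.

Lemma integral_powR_left_le a b p : 0 < p ->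
  (\int[lebesgue_measure]_(q in `]a, b[) ((q - a) `^ (p - 1))%:E <= ((b - a) `^ p / p)%:E)%E.
Proof.
move=> p0; apply: (@integral_le_primitive a b ((b - a) `^ p / p)
  (fun q => (q - a) `^ (p - 1)) (p^-1 \*: (fun q => (q - a) `^ p))).
- move=> x; rewrite in_itv/= => /andP[ax _].
  exact: is_derive_continuous (is_derive_powR_left _ ax).
- move=> x; rewrite in_itv/= => /andP[ax _].
  rewrite (_ : _ `^ (p - 1) = p^-1 *: (p * (x - a) `^ (p - 1))); last first.
    by rewrite /GRing.scale/= mulKf// gt_eqF.
  by apply: is_deriveZ; exact: is_derive_powR_left.
- by move=> x _; exact: powR_ge0.
- by rewrite divr_ge0 ?powR_ge0// ltW.
- move=> x y ax xy yb; rewrite /= -scalerBr /GRing.scale/= mulrC ler_pM2r ?invr_gt0//.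
  apply: le_trans (_ : (y - a) `^ p <= _); first by rewrite gerBl powR_ge0.
  rewrite ge0_ler_powR ?nnegrE ?subr_ge0 ?lerD2r//; try exact: ltW.
    by rewrite ltW// (lt_trans ax).
  by rewrite ltW// (lt_trans ax)// (lt_trans xy).
Qed.

Lemma integral_powR_right_le a b p : 0 < p ->
  (\int[lebesgue_measure]_(q in `]a, b[) ((b - q) `^ (p - 1))%:E <= ((b - a) `^ p / p)%:E)%E.
Proof.
move=> p0; apply: (@integral_le_primitive a b ((b - a) `^ p / p)
  (fun q => (b - q) `^ (p - 1)) ((- p^-1) \*: (fun q => (b - q) `^ p))).
- move=> x; rewrite in_itv/= => /andP[_ xb].
  exact: is_derive_continuous (is_derive_powR_right _ xb).
- move=> x; rewrite in_itv/= => /andP[_ xb].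
  rewrite (_ : _ `^ (p - 1) = - p^-1 *: (- (p * (b - x) `^ (p - 1)))); last first.
    by rewrite /GRing.scale/= mulrNN mulKf// gt_eqF.
  by apply: is_deriveZ; exact: is_derive_powR_right.
- by move=> x _; exact: powR_ge0.
- by rewrite divr_ge0 ?powR_ge0// ltW.
- move=> x y ax xy yb; rewrite /= -scalerBr /GRing.scale/= mulNr -mulrN opprB.
  rewrite mulrC ler_pM2r ?invr_gt0//.
  apply: le_trans (_ : (b - x) `^ p <= _); first by rewrite gerBl powR_ge0.
  rewrite ge0_ler_powR ?nnegrE ?subr_ge0 ?lerD2l ?lerN2//; try exact: ltW.
    by rewrite ltW// (lt_trans xy).
  by rewrite ltW// (lt_trans ax)// (lt_trans xy).
Qed.

Lemma measurable_powR_left (D : set R) a p : measurable_fun D (fun q => (q - a) `^ p).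
Proof.
apply: measurable_funTS; apply: (measurableT_comp (measurable_powR p)) => //.
exact: measurable_funB.
Qed.

Lemma measurable_powR_right (D : set R) b p : measurable_fun D (fun q => (b - q) `^ p).
Proof.
apply: measurable_funTS; apply: (measurableT_comp (measurable_powR p)) => //.
exact: measurable_funB.
Qed.

Lemma measurable_three_powers (D : set R) a b c1 c2 c3 p1 p2 p3 :
  measurable_fun D (fun q => (c1 * (q - a) `^ (p1 - 1) + c2 * (b - q) `^ (p2 - 1)
    + c3 * (b - q) `^ (p3 - 1))%:E).
Proof.
apply/measurable_EFinP; apply: measurable_funD; [apply: measurable_funD|];
  apply: measurable_funM => //; first [exact: measurable_powR_left | exact: measurable_powR_right].
Qed.

(** One singularity at the left end and two of different order at the right end majorise every
    kernel below; with exponents written p - 1, integrability is 0 < p. *)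
Lemma integral_three_powers_le a b c1 c2 c3 p1 p2 p3 :
  0 <= c1 -> 0 <= c2 -> 0 <= c3 -> 0 < p1 -> 0 < p2 -> 0 < p3 ->
  (\int[lebesgue_measure]_(q in `]a, b[)
     (c1 * (q - a) `^ (p1 - 1) + c2 * (b - q) `^ (p2 - 1) + c3 * (b - q) `^ (p3 - 1))%:E
   <= (c1 * ((b - a) `^ p1 / p1) + c2 * ((b - a) `^ p2 / p2) + c3 * ((b - a) `^ p3 / p3))%:E)%E.
Proof.
move=> c10 c20 c30 p10 p20 p30.
have mL0 p := @measurable_powR_left (`]a, b[%classic : set R) a (p - 1).
have mR0 p := @measurable_powR_right (`]a, b[%classic : set R) b (p - 1).
have mL c p : measurable_fun (`]a, b[%classic : set R) (fun q => (c * (q - a) `^ (p - 1))%:E).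
  exact/measurable_EFinP/measurable_funM.
have mR c p : measurable_fun (`]a, b[%classic : set R) (fun q => (c * (b - q) `^ (p - 1))%:E).
  exact/measurable_EFinP/measurable_funM.
have mLE p : measurable_fun (`]a, b[%classic : set R) (fun q => ((q - a) `^ (p - 1))%:E).
  by apply/measurable_EFinP; exact: mL0.
have mRE p : measurable_fun (`]a, b[%classic : set R) (fun q => ((b - q) `^ (p - 1))%:E).
  by apply/measurable_EFinP; exact: mR0.
have nn c x r : 0 <= c -> (0%:E <= (c * x `^ r)%:E)%E.
  by move=> c0; rewrite lee_fin mulr_ge0 ?powR_ge0.
under eq_integral do rewrite !EFinD.
rewrite ge0_integralD//=; try first [exact: mR | exact: mL | by apply: emeasurable_funD; [exact: mL|exact: mR]
  | by move=> x _; exact: nn | by move=> x _; rewrite adde_ge0// nn].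
rewrite ge0_integralD//=; try first [exact: mR | exact: mL | by move=> x _; exact: nn].
rewrite !EFinD; apply: leeD; [apply: leeD|].
- under eq_integral do rewrite EFinM.
  rewrite ge0_integralZl_EFin//=; try by move=> x _; rewrite lee_fin powR_ge0.
    by rewrite EFinM lee_wpmul2l// ?lee_fin// integral_powR_left_le.
  exact: mLE.
- under eq_integral do rewrite EFinM.
  rewrite ge0_integralZl_EFin//=; try by move=> x _; rewrite lee_fin powR_ge0.
    by rewrite EFinM lee_wpmul2l// ?lee_fin// integral_powR_right_le.
  exact: mRE.
- under eq_integral do rewrite EFinM.
  rewrite ge0_integralZl_EFin//=; try by move=> x _; rewrite lee_fin powR_ge0.
    by rewrite EFinM lee_wpmul2l// ?lee_fin// integral_powR_right_le.
  exact: mRE.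
Qed.

End PowerIntegrals.

(** * Bounds for the weak Bochner integral *)

Section WeakIntegral.
Context {R : realType} {V : completeNormedModType R} (ip : V -> V -> R).
Hypothesis hip : inner_product ip.
Context {I : countType} (e : I -> V) (lam : I -> R).
Local Notation Vle := (Vle ip e lam).

(** If no Bochner integral exists the value is the default 0 and the bound is trivial; otherwise
    pairing with a test vector leaves a scalar integral. *)
Lemma bint_Vle d a b f c1 c2 c3 p1 p2 p3 :
  0 <= c1 -> 0 <= c2 -> 0 <= c3 -> 0 < p1 -> 0 < p2 -> 0 < p3 -> a < b ->
  (forall r, a < r -> r < b ->
     Vle d (f r) (c1 * (r - a) `^ (p1 - 1) + c2 * (b - r) `^ (p2 - 1)
                  + c3 * (b - r) `^ (p3 - 1))) ->
  Vle d (bint ip a b f)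
    (c1 * ((b - a) `^ p1 / p1) + c2 * ((b - a) `^ p2 / p2) + c3 * ((b - a) `^ p3 / p3)).
Proof.
move=> c10 c20 c30 p10 p20 p30 ab hf.
have hc q c : 0 < q -> 0 <= c -> 0 <= c * ((b - a) `^ q / q).
  by move=> q0 c0; rewrite mulr_ge0// divr_ge0 ?powR_ge0// ltW.
rewrite /bint; case: xgetP => [y _ [mf _ hy]|_]; last first.
  by apply: (Vle_zero hip); rewrite !addr_ge0 ?hc.
move=> v z vz; rewrite hy /Rintegral -lee_fin.
have mfz : measurable_fun (`[a, b]%classic : set R) (fun r => (ip (f r) z)%:E).
  exact/measurable_EFinP.
have mfo : measurable_fun (`]a, b[%classic : set R) (fun r => (ip (f r) z)%:E).
  by apply: measurable_funS mfz => //; exact: subset_itv_oo_cc.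
have abs_fine (x : \bar R) : (`|fine x|%:E <= `|x|)%E.
  by case: x => [r||] //=; rewrite normr0 leey.
apply: le_trans (abs_fine _) _.
apply: (@le_trans _ _ (\int[lebesgue_measure]_(r in `[a, b]) `|(ip (f r) z)%:E|)%E).
  exact: le_abse_integral.
(* The pointwise bound is given only inside: at the endpoints a negative power of 0 is 0 and bounds
   nothing. They form a null set. *)
rewrite (@integral_itv_bndoo R a b (fun r => `|(ip (f r) z)%:E|%E)); last first.
  exact: measurableT_comp.
have hv c : 0 <= c -> 0 <= c * `|v| by move=> c0; rewrite mulr_ge0.
have := integral_three_powers_le a b (hv _ c10) (hv _ c20) (hv _ c30) p10 p20 p30.
rewrite [X in (_ <= X)%E -> _](_ : _ =
  ((c1 * ((b - a) `^ p1 / p1) + c2 * ((b - a) `^ p2 / p2) + c3 * ((b - a) `^ p3 / p3)) * `|v|)%:E); last first.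
  by congr EFin; ring.
apply: le_trans; apply: ge0_le_integral => //.
- exact: measurableT_comp.
- exact: measurable_three_powers.
- move=> r; rewrite /= in_itv/= => /andP[ar rb].
  rewrite lee_fin (le_trans (hf _ ar rb v z vz))//.
  by rewrite le_eqVlt; apply/orP; left; apply/eqP; ring.
Qed.

End WeakIntegral.

(** * Real powers and products of two singularities *)

Section PowerAlgebra.
Context {R : realType}.
Implicit Types x y a b r q : R.

Lemma powR_add x a b : 0 < x -> x `^ (a + b) = x `^ a * x `^ b.
Proof. by move=> x0; rewrite powRD// (lt0r_neq0 x0) implybT. Qed.

Lemma powR_half r a : 0 < r -> (r / 2) `^ (- a) = 2 `^ a * r `^ (- a).
Proof.
move=> r0; rewrite powRM ?invr_ge0 ?(ltW r0)// mulrC; congr (_ * _).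
by rewrite -powR_inv1// -powRrM mulN1r opprK.
Qed.

Lemma le_powRN x y a : 0 < x -> x <= y -> 0 <= a -> y `^ (- a) <= x `^ (- a).
Proof.
move=> x0 xy a0; have y0 : 0 < y by exact: lt_le_trans xy.
by rewrite !powRN lef_pV2 ?posrE ?powR_gt0// ge0_ler_powR// nnegrE ltW.
Qed.

(* One of [q] and [r - q] is at least [r / 2]. *)
Lemma powRN_mul_le r q a b : 0 < q -> q < r -> 0 <= a -> 0 <= b ->
  q `^ (- a) * (r - q) `^ (- b) <=
  (r / 2) `^ (- b) * q `^ (- a) + (r / 2) `^ (- a) * (r - q) `^ (- b).
Proof.
move=> q0 qr a0 b0; have r2 : 0 < r / 2 by lra.
have [h|/ltW h] := leP (r / 2) q.
  have h1 := le_powRN r2 h a0.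
  apply: le_trans (_ : (r / 2) `^ (- a) * (r - q) `^ (- b) <= _).
    by rewrite ler_wpM2r ?powR_ge0.
  by rewrite lerDr mulr_ge0 ?powR_ge0.
have h1 : (r - q) `^ (- b) <= (r / 2) `^ (- b) by apply: le_powRN => //; lra.
apply: le_trans (_ : (r / 2) `^ (- b) * q `^ (- a) <= _).
  by rewrite mulrC ler_wpM2r ?powR_ge0.
by rewrite lerDl mulr_ge0 ?powR_ge0.
Qed.

End PowerAlgebra.

Lemma linear_sub (R : pzRingType) (U W : lmodType R) (f : U -> W) x y :
  linear f -> f (x - y) = f x - f y.
Proof. by move=> lf; rewrite addrC -scaleN1r lf scaleN1r addrC. Qed.

(** * Young-type bounds for the pathwise integral *)

Section IntegralBound.
Context {R : realType} {V : completeNormedModType R} (ip : V -> V -> R).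
Hypothesis hip : inner_product ip.
Context {I : countType} (e : I -> V) (lam : I -> R).
Context (DA : set V) (A : V -> V) (S : R -> V -> V).
Hypothesis heig : eigenbasis_opp ip DA A e lam.
Hypothesis hpos : strictly_positive_opp ip DA A.
Hypothesis hS : generates_semigroup DA A S.
Context (G : V -> V -> V) (M : R).
Hypothesis M0 : 0 <= M.
Hypothesis Glip : forall x y v, `|G y v - G x v| <= M * `|y - x| * `|v|.
Hypothesis Ggrowth : forall x v, `|G x v| <= M * (1 + `|x|) * `|v|.
Context (al b b' : R).
Hypothesis exps : [/\ 0 < al, al < b, b < b', b' < 1 & 1 - b' < al].
Local Notation Vle := (Vle ip e lam).

(** The order b' - (1 - al) left to a b'-Hoelder path by a fractional derivative of order 1 - al;
    positive because 1 - b' < al. *)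
Let kap := b' + al - 1.
(* Any exponent in ]al, al + b' - b[ keeps the kernels of [fracL] and [wint]
   integrable, in V as well as in V_b. *)
Let gam := al + (b' - b) / 2.

(** Both terms have order [kap]: the boundary term directly, the integral because its kernel is at
    most m (q - r)^(kap - 1). *)
Lemma fracR_bound : exists2 C, 0 <= C & forall (w : R -> V) m t r, 0 <= m ->
  (forall r q, 0 <= r -> r < q -> q <= t -> `|w q - w r| <= m * (q - r) `^ b') ->
  0 < r -> r < t -> `|fracR ip al t w r| <= C * m * (t - r) `^ kap.
Proof.
have [al0 alb bb' b'1 alb'] := exps.
have k0 : 0 < kap by rewrite /kap; lra.
exists (`|(Gamma al)^-1| * (1 + (1 - al) / kap)) => [|w m t r m0 hw r0 rt].
  by rewrite mulr_ge0// addr_ge0// divr_ge0 ?(ltW k0)//; lra.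
have tr : 0 < t - r by lra.
rewrite /fracR normrZ -!mulrA ler_wpM2l//.
rewrite mulrDl mul1r (le_trans (ler_normD _ _))// lerD//.
  rewrite normrZ normfV (ger0_norm (powR_ge0 _ _)) -powRN distrC.
  apply: le_trans (_ : (t - r) `^ (- (1 - al)) * (m * (t - r) `^ b') <= _).
    by rewrite ler_wpM2l ?powR_ge0// hw// ltW.
  rewrite mulrCA ler_wpM2l// -powR_add//.
  by rewrite (_ : - (1 - al) + b' = kap)// /kap; ring.
rewrite normrZ ger0_norm -?mulrA; last by lra.
rewrite ler_wpM2l//; first by lra.
apply: (Vle0_norm (ip := ip) hip (e := e) (lam := lam)).
  by rewrite mulr_ge0 ?invr_ge0 ?(ltW k0)// mulr_ge0 ?powR_ge0.
apply: Vle_le (_ : m * ((t - r) `^ kap / kap) <= _) _.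
  by rewrite mulrC -mulrA mulrC -mulrA.
(* Exponent 0 makes [Vle] a bound on the norm; zero coefficients switch off two of the three
   powers. *)
have := @bint_Vle _ _ ip hip _ e lam 0 r t
  (fun q => ((q - r) `^ (2 - al))^-1 *: (w r - w q)) m 0 0 kap 1 1
  m0 (lexx _) (lexx _) k0 ltr01 ltr01 rt.
rewrite !mul0r !addr0.
apply=> q rq qt; rewrite !mul0r !addr0; apply: (norm_Vle0 hip heig).
rewrite normrZ normfV (ger0_norm (powR_ge0 _ _)) -powRN distrC.
apply: le_trans (_ : (q - r) `^ (- (2 - al)) * (m * (q - r) `^ b') <= _).
  by rewrite ler_wpM2l ?powR_ge0// hw// ?ltW.
rewrite mulrCA ler_wpM2l// -powR_add ?subr_gt0//.
by rewrite (_ : - (2 - al) + b' = kap - 1)// /kap; ring.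
Qed.

Section Convolution.
Context (d : R).
Hypothesis d0b : 0 <= d <= b.

Lemma convolution_bound (K : R -> V -> V) (v : R -> V) (t U W r : R) (x : V) :
  0 <= U -> 0 <= W -> K = (fun q y => S (t - q) (G (v q) y)) ->
  (forall q : R, 0 <= q -> q <= t -> `|v q| <= U) ->
  0 < r -> r < t -> Vle d (K r x) (4 * (t - r) `^ (- d) * (M * (1 + U) * `|x|)).
Proof.
have [al0 alb bb' b'1 alb'] := exps; have /andP[d0 db] := d0b.
move=> U0 W0 -> hU r0 rt.
have tr : 0 < t - r by lra.
apply: Vle_le (semigroup_smoothing hip heig hpos hS _ tr _); last by lra.
rewrite ler_wpM2l ?mulr_ge0 ?powR_ge0// (le_trans (Ggrowth _ _))//.
by rewrite ler_wpM2r// ler_wpM2l// lerD2l hU// ltW.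
Qed.

(** Two changes are separated: that of v at fixed semigroup time, paid by the Lipschitz bound, and
    that of the semigroup time at fixed v q, which gains (r - q)^gam for an extra singularity of
    order gam at t. *)
Lemma convolution_diff_bound (K : R -> V -> V) (v : R -> V) (t U W r q : R) (x : V) :
  0 <= U -> 0 <= W -> K = (fun q y => S (t - q) (G (v q) y)) ->
  (forall q : R, 0 <= q -> q <= t -> `|v q| <= U) ->
  (forall q r : R, 0 < q -> q < r -> r <= t -> `|v r - v q| <= W * q `^ (- b) * (r - q) `^ b) ->
  0 < q -> q < r -> r < t ->
  Vle d (K r x - K q x) (4 * (t - r) `^ (- d) * M * W * `|x| * (q `^ (- b) * (r - q) `^ b)
     + 4 * (t - r) `^ (- (gam + d)) * M * (1 + U) * `|x| * (r - q) `^ gam).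
Proof.
have [al0 alb bb' b'1 alb'] := exps; have /andP[d0 db] := d0b.
move=> U0 W0 -> hU hW q0 qr rt.
have tr : 0 < t - r by lra.
have rq : 0 <= r - q by lra.
have -> : S (t - r) (G (v r) x) - S (t - q) (G (v q) x) =
    S (t - r) (G (v r) x - G (v q) x)
    + (S (t - r) (G (v q) x) - S (t - r + (r - q)) (G (v q) x)).
  by rewrite (linear_sub _ _ (sg_linear hS (ltW tr))) addrA subrK addrA subrK.
apply: (Vle_add hip).
  apply: Vle_le (semigroup_smoothing hip heig hpos hS _ tr _); last by lra.
  rewrite -!mulrA ler_wpM2l// ler_wpM2l ?powR_ge0//.
  apply: le_trans (Glip _ _ _) _; rewrite -!mulrA ler_wpM2l//.
  by rewrite (mulrC `|x|) !mulrA ler_wpM2r// hW// ltW.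
have g01 : 0 <= gam <= 1 by rewrite /gam; lra.
have d01 : 0 <= d <= 1 by lra.
apply: Vle_le (semigroup_smoothing_diff hip heig hpos hS _ tr rq d01 g01).
rewrite [leRHS](_ : _ = 4 * (r - q) `^ gam * (t - r) `^ (- (gam + d)) * (M * (1 + U) * `|x|)); last by ring.
rewrite ler_wpM2l ?mulr_ge0 ?powR_ge0// (le_trans (Ggrowth _ _))//.
by rewrite ler_wpM2r// ler_wpM2l// lerD2l hU//; lra.
Qed.

(** In the integral term, q^(-b) (r - q)^(b - 1 - al) is singular at both ends and is split by
    [powRN_mul_le]; its integral has order r^(- al), like the boundary term. The part with (r -
    q)^gam integrates to order r^(gam - al). *)
Lemma fracL_bound : exists2 C, 0 <= C & forall (K : R -> V -> V) (v : R -> V) (t U W r : R) (x : V),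
  0 <= U -> 0 <= W -> K = (fun q y => S (t - q) (G (v q) y)) ->
  (forall q : R, 0 <= q -> q <= t -> `|v q| <= U) ->
  (forall q r : R, 0 < q -> q < r -> r <= t -> `|v r - v q| <= W * q `^ (- b) * (r - q) `^ b) ->
  0 < r -> r < t ->
  Vle d (fracL ip al 0 K r x) (C * (1 + U + W) * `|x| *
    (r `^ (- al) * (t - r) `^ (- d) + r `^ (gam - al) * (t - r) `^ (- (gam + d)))).
Proof.
have [al0 alb bb' b'1 alb'] := exps; have /andP[d0 db] := d0b.
have ga : 0 < gam - al by rewrite /gam; lra.
have b0 : 0 <= b by lra.
have alb1 : 0 <= 1 + al - b by lra.
(* The two integrals of the split kernel; the powers of 2 come from evaluating the harmless factor
   at r / 2. *)
pose B := 2 `^ (1 + al - b) / (1 - b) + 2 `^ b / (b - al).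
have B0 : 0 <= B.
  by rewrite addr_ge0// divr_ge0 ?powR_ge0//; lra.
pose C1 := al * (4 * M * B) + 4 * M.
pose C2 := al * (4 * M / (gam - al)).
have C10 : 0 <= C1 by rewrite addr_ge0 ?mulr_ge0//; lra.
have C20 : 0 <= C2 by rewrite !mulr_ge0 ?invr_ge0//; lra.
exists (`|(Gamma (1 - al))^-1| * (C1 + C2)) => [|K v t U W r x U0 W0 KE hU hW r0 rt].
  by rewrite mulr_ge0// addr_ge0.
have tr : 0 < t - r by lra.
rewrite /fracL subr0 -!mulrA; apply: (Vle_scale hip).
set N := 1 + U + W.
set P := r `^ (- al) * (t - r) `^ (- d); set Q := r `^ (gam - al) * _.
have P0 : 0 <= P by rewrite mulr_ge0 ?powR_ge0.
have Q0 : 0 <= Q by rewrite mulr_ge0 ?powR_ge0.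
have N0 : 0 <= N by rewrite /N; lra.
have h1 : Vle d ((r `^ al)^-1 *: K r x) (4 * M * N * `|x| * P).
  apply: Vle_le (Vle_scale hip _ (convolution_bound x U0 W0 KE hU r0 rt)).
  rewrite normfV (ger0_norm (powR_ge0 _ _)) -powRN.
  rewrite [leLHS](_ : _ = 4 * M * (1 + U) * `|x| * P); last by rewrite /P; ring.
  rewrite ler_wpM2r// ler_wpM2r// ler_wpM2l ?mulr_ge0//.
  by rewrite /N; lra.
have h2 : Vle d (bint ip 0 r (fun q => ((r - q) `^ (1 + al))^-1 *: (K r x - K q x)))
    (4 * M * B * N * `|x| * P + 4 * M / (gam - al) * N * `|x| * Q).
  pose A0 := 4 * (t - r) `^ (- d) * M * W * `|x|.
  pose B1 := 4 * (t - r) `^ (- (gam + d)) * M * (1 + U) * `|x|.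
  have A00 : 0 <= A0 by rewrite !mulr_ge0 ?powR_ge0.
  have B10 : 0 <= B1 by rewrite !mulr_ge0 ?powR_ge0//; lra.
  have b1 : 0 < 1 - b by lra.
  have ba : 0 < b - al by lra.
  have Ar1 : 0 <= A0 * (r / 2) `^ (- (1 + al - b)) by rewrite mulr_ge0 ?powR_ge0.
  have Ar2 : 0 <= A0 * (r / 2) `^ (- b) by rewrite mulr_ge0 ?powR_ge0.
  apply: Vle_le (bint_Vle hip (c1 := A0 * (r / 2) `^ (- (1 + al - b)))
    (c2 := A0 * (r / 2) `^ (- b)) (c3 := B1) (p1 := 1 - b) (p2 := b - al)
    (p3 := gam - al) Ar1 Ar2 B10 b1 ba ga r0 _).
    rewrite subr0 !powR_half//.
    have E1 : r `^ (- (1 + al - b)) * r `^ (1 - b) = r `^ (- al).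
      by rewrite -powR_add//; congr (_ `^ _); ring.
    have E2 : r `^ (- b) * r `^ (b - al) = r `^ (- al).
      by rewrite -powR_add//; congr (_ `^ _); ring.
    apply: lerD.
      rewrite [leLHS](_ : _ = A0 * (2 `^ (1 + al - b) / (1 - b) * (r `^ (- (1 + al - b)) * r `^ (1 - b))
         + 2 `^ b / (b - al) * (r `^ (- b) * r `^ (b - al)))); last by ring.
      rewrite E1 E2 -mulrDl -/B.
      rewrite [leLHS](_ : _ = 4 * M * B * W * `|x| * P); last by rewrite /A0 /P; ring.
      rewrite ler_wpM2r// ler_wpM2r// ler_wpM2l ?mulr_ge0//.
      by rewrite /N; lra.
    rewrite [leLHS](_ : _ = 4 * M / (gam - al) * (1 + U) * `|x| * Q); last by rewrite /B1 /Q; ring.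
    rewrite ler_wpM2r// ler_wpM2r// ler_wpM2l ?mulr_ge0 ?invr_ge0 ?(ltW ga)//.
    by rewrite /N; lra.
  move=> q q0 qr.
  apply: Vle_le (Vle_scale hip _ (convolution_diff_bound x U0 W0 KE hU hW q0 qr rt)).
  have rq : 0 < r - q by lra.
  rewrite normfV (ger0_norm (powR_ge0 _ _)) -powRN subr0 -/A0 -/B1 mulrDr.
  apply: lerD.
    rewrite [leLHS](_ : _ = A0 * (q `^ (- b) * ((r - q) `^ (- (1 + al)) * (r - q) `^ b))); last by ring.
    rewrite -powR_add// (_ : - (1 + al) + b = - (1 + al - b)); last by ring.
    have := powRN_mul_le q0 qr (a := b) (b := 1 + al - b).
    have -> : 1 - b - 1 = - b by ring.
    have -> : b - al - 1 = - (1 + al - b) by ring.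
    move=> h; rewrite [leRHS](_ : _ = A0 * ((r / 2) `^ (- (1 + al - b)) * q `^ (- b) +
      (r / 2) `^ (- b) * (r - q) `^ (- (1 + al - b)))); last by ring.
    by rewrite ler_wpM2l// h.
  rewrite mulrCA -powR_add// (_ : - (1 + al) + gam = gam - al - 1)//; ring.
apply: Vle_le (Vle_add hip h1 (Vle_scale hip al h2)).
rewrite (ger0_norm (ltW al0)).
rewrite [leLHS](_ : _ = N * `|x| * (C1 * P + C2 * Q)); last by rewrite /C1 /C2; ring.
rewrite [leRHS](_ : _ = N * `|x| * ((C1 + C2) * (P + Q))); last by ring.
rewrite ler_wpM2l ?mulr_ge0// -subr_ge0.
rewrite (_ : _ - _ = C1 * Q + C2 * P); last by ring.
by rewrite addr_ge0// mulr_ge0.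
Qed.

(** All terms of the product of the two fractional derivatives integrate to the scale t^(b' - d).
    The lemma is applied with d = 0 for the norm of V and with d = b for that of V_b. *)
Lemma wint_bound : exists2 C, 0 <= C &
  forall (v : R -> V) (w : R -> V) (t U W m : R), 0 < t ->
  0 <= U -> 0 <= W -> 0 <= m ->
  (forall q : R, 0 <= q -> q <= t -> `|v q| <= U) ->
  (forall q r : R, 0 < q -> q < r -> r <= t -> `|v r - v q| <= W * q `^ (- b) * (r - q) `^ b) ->
  (forall r q, 0 <= r -> r < q -> q <= t -> `|w q - w r| <= m * (q - r) `^ b') ->
  Vle d (wint ip al 0 t (fun q y => S (t - q) (G (v q) y)) w)
    (C * m * (1 + U + W) * t `^ (b' - d)).
Proof.
have [al0 alb bb' b'1 alb'] := exps; have /andP[d0 db] := d0b.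
have [CL CL0 hL] := fracL_bound; have [CR CR0 hR] := fracR_bound.
(* This is kap - (gam + d) + 1, the integrability exponent of the worst singularity at t; at d = b
   it is still (b' - b) / 2. *)
pose p3 := b' - d - (b' - b) / 2.
have p30 : 0 < p3 by rewrite /p3; lra.
have k0 : 0 <= kap by rewrite /kap; lra.
have ga : 0 <= gam - al by rewrite /gam; lra.
pose D := 2 `^ d / (1 - al) + 2 `^ al / (1 - d) + p3^-1.
have D0 : 0 <= D.
  by rewrite !addr_ge0 ?invr_ge0 ?(ltW p30)// divr_ge0 ?powR_ge0//; lra.
exists (CL * CR * D) => [|v w t U W m t0 U0 W0 m0 hU hW hw].
  by rewrite !mulr_ge0.
rewrite /wint; apply: (Vle_opp hip).
set N := 1 + U + W.
have N0 : 0 <= N by rewrite /N; lra.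
pose C0 := CL * N * (CR * m).
have C00 : 0 <= C0 by rewrite !mulr_ge0.
have c10 : 0 <= C0 * t `^ kap * (t / 2) `^ (- d) by rewrite !mulr_ge0 ?powR_ge0.
have c20 : 0 <= C0 * t `^ kap * (t / 2) `^ (- al) by rewrite !mulr_ge0 ?powR_ge0.
have c30 : 0 <= C0 * t `^ (gam - al) by rewrite !mulr_ge0 ?powR_ge0.
have p10 : 0 < 1 - al by lra.
have p20 : 0 < 1 - d by lra.
apply: Vle_le (bint_Vle hip c10 c20 c30 p10 p20 p30 t0 _).
  rewrite subr0 !powR_half//.
  have E1 : t `^ kap * t `^ (- d) * t `^ (1 - al) = t `^ (b' - d).
    by rewrite -!powR_add//; congr (_ `^ _); rewrite /kap; ring.
  have E2 : t `^ kap * t `^ (- al) * t `^ (1 - d) = t `^ (b' - d).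
    by rewrite -!powR_add//; congr (_ `^ _); rewrite /kap; ring.
  have E3 : t `^ (gam - al) * t `^ p3 = t `^ (b' - d).
    by rewrite -!powR_add//; congr (_ `^ _); rewrite /gam /p3; ring.
  rewrite [leLHS](_ : _ = C0 * (2 `^ d / (1 - al) * (t `^ kap * t `^ (- d) * t `^ (1 - al))
      + 2 `^ al / (1 - d) * (t `^ kap * t `^ (- al) * t `^ (1 - d))
      + p3^-1 * (t `^ (gam - al) * t `^ p3))); last by ring.
  rewrite E1 E2 E3 -!mulrDl -/D.
  by rewrite (_ : C0 * _ = CL * CR * D * m * N * t `^ (b' - d))// /C0; ring.
move=> r r0 rt; have tr : 0 < t - r by lra.
apply: Vle_le (hL _ v t U W r (fracR ip al t w r) U0 W0 erefl hU hW r0 rt).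
have hx := hR w m t r m0 hw r0 rt.
set Q := r `^ (- al) * _ + _.
have Q0 : 0 <= Q by rewrite addr_ge0// mulr_ge0 ?powR_ge0.
apply: le_trans (_ : CL * N * (CR * m * (t - r) `^ kap) * Q <= _).
  by rewrite ler_wpM2r// ler_wpM2l ?mulr_ge0.
rewrite [leLHS](_ : _ = C0 * ((t - r) `^ kap * (r `^ (- al) * (t - r) `^ (- d))
   + r `^ (gam - al) * ((t - r) `^ kap * (t - r) `^ (- (gam + d))))); last by rewrite /C0 /Q; ring.
rewrite [leRHS](_ : _ = C0 * (t `^ kap * ((t / 2) `^ (- d) * r `^ (- al) +
   (t / 2) `^ (- al) * (t - r) `^ (- d)) + t `^ (gam - al) * (t - r) `^ (p3 - 1))); last first.
  rewrite subr0 (_ : 1 - al - 1 = - al); last by ring.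
  by rewrite (_ : 1 - d - 1 = - d); ring.
rewrite ler_wpM2l//; apply: lerD.
  apply: ler_pM; rewrite ?mulr_ge0 ?powR_ge0//.
    by rewrite ge0_ler_powR ?nnegrE ?(ltW tr) ?(ltW t0) ?gerBl ?(ltW r0).
  by apply: powRN_mul_le; rewrite // ltW.
rewrite -powR_add//.
rewrite (_ : kap - (gam + d) = p3 - 1); last by rewrite /kap /gam /p3; field.
rewrite ler_wpM2r ?powR_ge0// ge0_ler_powR ?nnegrE//; exact: ltW.
Qed.

End Convolution.

End IntegralBound.

(** * The weighted Hoelder norm as a pair of real bounds *)

Section WeightedNorm.
Context {R : realType} {V : completeNormedModType R}.
Implicit Types (u : R -> V) (b T X : R).

(** The last two clauses record that [U] and [W] are least: an estimate of the values in terms of U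
    and W then becomes an inequality for U and W themselves. *)
Lemma wnorm_finite u b T : 0 < T -> Cwhol b 0 T u -> exists U W, [/\ 0 <= U /\ 0 <= W,
  forall t, 0 <= t -> t <= T -> `|u t| <= U,
  forall s t, 0 < s -> s < t -> t <= T -> `|u t - u s| <= W * s `^ (- b) * (t - s) `^ b,
  forall X, (forall t, 0 <= t -> t <= T -> `|u t| <= X) -> U <= X &
  forall X, (forall s t, 0 < s -> s < t -> t <= T ->
    s `^ b * (`|u t - u s| / (t - s) `^ b) <= X) -> W <= X].
Proof.
move=> T0 [_]; rewrite /wnorm => hfin.
have sup0 : (0 <= supnorm u 0 T)%E.
  apply: le_trans (_ : (`|u 0|%:E <= _)%E); first by rewrite lee_fin.
  by apply: ereal_sup_ubound; exists 0 => //=; rewrite in_itv/= lexx ltW.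
have w0 : (0 <= wseminorm b u 0 T)%E.
  apply: le_trans (_ : (((T / 2 - 0) `^ b * (`|u T - u (T / 2)| / (T - T / 2) `^ b))%:E <= _)%E).
    by rewrite lee_fin !mulr_ge0 ?invr_ge0 ?powR_ge0.
  by apply: ereal_sup_ubound; exists (T / 2), T; split => //; lra.
have supoo : (supnorm u 0 T < +oo)%E by apply: le_lt_trans hfin; rewrite leeDl.
have woo : (wseminorm b u 0 T < +oo)%E by apply: le_lt_trans hfin; rewrite leeDr.
have supE : (fine (supnorm u 0 T))%:E = supnorm u 0 T by rewrite fineK// ge0_fin_numE.
have wE : (fine (wseminorm b u 0 T))%:E = wseminorm b u 0 T by rewrite fineK// ge0_fin_numE.
exists (fine (supnorm u 0 T)), (fine (wseminorm b u 0 T)); split.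
- by split; exact: fine_ge0.
- move=> t t0 tT; rewrite -lee_fin supE; apply: ereal_sup_ubound.
  by exists t => //=; rewrite in_itv/= t0 tT.
- move=> s t s0 st tT.
  have : (s `^ b * (`|u t - u s| / (t - s) `^ b) <= fine (wseminorm b u 0 T)).
    rewrite -lee_fin wE; apply: ereal_sup_ubound; exists s, t; split => //.
    by rewrite subr0.
  rewrite mulrA ler_pdivrMr ?powR_gt0 ?subr_gt0// mulrC -ler_pdivlMr ?powR_gt0//.
  by rewrite powRN mulrAC.
- move=> X hX; rewrite -lee_fin supE; apply: ge_ereal_sup => _ [t tT <-].
  by move: tT; rewrite /= in_itv/= => /andP[t0 tT]; rewrite lee_fin hX.
- move=> X hX; rewrite -lee_fin wE; apply: ge_ereal_sup => _ [s [t [s0 st tT ->]]].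
  by rewrite subr0 lee_fin hX.
Qed.

End WeightedNorm.

(** * Linear growth of solutions over one unit of time *)

Section Growth.
Context {R : realType} {V : completeNormedModType R} (ip : V -> V -> R).
Hypothesis hip : inner_product ip.
Context {I : countType} (e : I -> V) (lam : I -> R).
Context (DA : set V) (A : V -> V) (S : R -> V -> V).
Hypothesis heig : eigenbasis_opp ip DA A e lam.
Hypothesis hpos : strictly_positive_opp ip DA A.
Hypothesis hS : generates_semigroup DA A S.
Context (G : V -> V -> V) (hG : C2b e G).
Context (al b b' : R).
Hypothesis exps : [/\ 0 < al, al < b, b < b', b' < 1 & 1 - b' < al].
Context (Omega : set (R -> V)) (phi : R -> (R -> V) -> V -> V) (Vb : set V).
Hypothesis hphi : solution_cocycle ip al b S G Vb Omega phi.
Hypothesis theta_Omega : forall t w, Omega w -> Omega (theta t w).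

Definition holder_le (w : R -> V) (m T : R) : Prop :=
  forall r q, 0 <= r -> r < q -> q <= T -> `|w q - w r| <= m * (q - r) `^ b'.

Lemma holder_le_theta w m T s : 0 <= s -> holder_le w m T -> holder_le (theta s w) m (T - s).
Proof.
move=> s0 h r q r0 rq qT; rewrite /theta opprB addrA subrK.
by by rewrite (_ : q - r = s + q - (s + r)); [apply: h; lra|ring].
Qed.

Lemma holder_le_sub w m T T' : T' <= T -> holder_le w m T -> holder_le w m T'.
Proof. by move=> TT h r q r0 rq qT; apply: h => //; exact: le_trans TT. Qed.

Lemma phi_shift w x s t T : Omega w -> 0 < T -> 0 <= s -> s < t -> t <= T ->
  phi t w x = S (t - s) (phi s w x) +
    wint ip al 0 (t - s) (fun q y => S (t - s - q) (G (phi q (theta s w) (phi s w x)) y))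
      (theta s w).
Proof.
move=> Ow T0 s0 st tT.
have -> : phi t w x = phi (t - s) (theta s w) (phi s w x).
  by rewrite -(sol_cocycle hphi)// ?subr_ge0 ?subrK// ltW.
have ts : 0 < t - s by rewrite subr_gt0.
have [_ ->//] := sol_mild hphi (phi s w x) (theta_Omega s Ow) ts.
by rewrite lexx ltW.
Qed.

(** The path is smoother than the solution by the positive order b' - b, which supplies the small
    factor on short intervals. *)
Lemma small_time (c : R) : 0 <= c -> exists l : R, [/\ 0 < l, l <= 1 & c * l `^ (b' - b) <= 1 / 2].
Proof.
have [al0 alb bb' b'1 alb'] := exps => c0.
pose x := (2 * (c + 1))^-1.
have x0 : 0 < x by rewrite invr_gt0; lra.
have cx : c * x <= 1 / 2.
  rewrite ler_pdivrMr; last by lra.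
  by rewrite mul1r; lra.
exists (Num.min 1 (x `^ (b' - b)^-1)); split.
- by rewrite lt_min ltr01 powR_gt0.
- by rewrite ge_min lexx.
apply: le_trans cx; rewrite ler_wpM2l//.
apply: le_trans (_ : (x `^ (b' - b)^-1) `^ (b' - b) <= _).
  rewrite ge0_ler_powR ?nnegrE ?le_min ?ler01 ?powR_ge0 ?ge_min ?lexx ?orbT//.
  by lra.
by rewrite -powRrM mulVf ?powRr1 ?(ltW x0)// gt_eqF// subr_gt0.
Qed.

(** The estimate is affine in N = 1 + U + W, so the length [l] on which the coefficient of N is at
    most 1/2 depends neither on [x] nor on the path, except through [m]; N is finite and can be
    absorbed. *)
Lemma local_growth m : 0 <= m -> exists l C, [/\ 0 < l, 0 <= C &
  forall w x T, Omega w -> 0 < T -> T <= l -> holder_le w m T ->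
  forall t, 0 <= t -> t <= T -> `|phi t w x| <= C * (1 + `|x|)].
Proof.
have [al0 alb bb' b'1 alb'] := exps.
have [DG [D2G hGG]] := hG.
have [M1 M10 hM1] := lipschitz_nonlinearity hip (eigb_orth heig) (eigb_total heig) hGG.
have [M2 M20 hM2] := linear_growth_nonlinearity hip (eigb_orth heig) (eigb_total heig) hGG.
pose M := M1 + M2; have M0 : 0 <= M by rewrite addr_ge0.
have Glip x y v : `|G y v - G x v| <= M * `|y - x| * `|v|.
  by apply: le_trans (hM1 x y v) _; rewrite ler_wpM2r// ler_wpM2r// /M lerDl.
have Ggr x v : `|G x v| <= M * (1 + `|x|) * `|v|.
  by apply: le_trans (hM2 x v) _; rewrite ler_wpM2r// ler_wpM2r ?addr_ge0// /M lerDr.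
have [MS MS0 hMS] := semigroup_bounded hS.
move=> m0.
have z0 : (0 : R) <= 0 <= b by lra.
have zb : 0 <= b <= b by lra.
have b01 : 0 <= b <= 1 by lra.
have [C0 C00 hC0] := wint_bound hip heig hpos hS M0 Glip Ggr exps z0.
have [Cb Cb0 hCb] := wint_bound hip heig hpos hS M0 Glip Ggr exps zb.
have c0 : 0 <= (2 * C0 + Cb) * m by rewrite mulr_ge0// addr_ge0// mulr_ge0.
have [l [l0 l1 hl]] := small_time c0.
(* MS + 1 from the supremum, 4 from the weighted seminorm, doubled by the absorption. *)
exists l, (2 * (MS + 5)); split => //; first by lra.
move=> w x T Ow T0 Tl hw.
have [hu _] := sol_mild hphi x Ow T0.
have [U [W [[U0 W0] hU hW minU minW]]] := wnorm_finite T0 hu.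
pose N := 1 + U + W; have N0 : 0 <= N by rewrite /N; lra.
pose L := l `^ (b' - b); have L0 : 0 <= L := powR_ge0 _ _.
have powL t p : 0 <= t -> t <= T -> b' - b <= p -> t `^ p <= L.
  move=> t0 tT bp; apply: le_trans (_ : l `^ p <= _).
    rewrite ge0_ler_powR ?nnegrE//; [|exact: ltW|exact: le_trans Tl].
    by apply: le_trans bp; rewrite subr_ge0 ltW.
  by rewrite ger_powR// l0 l1.
(* The solution restarted at s obeys the same U and W, since its weight (q + s)^(-b) is at most
   q^(-b). *)
have wbound d s t C : 0 <= s -> s < t -> t <= T ->
    (forall (v : R -> V) (w : R -> V) (t U W m : R), 0 < t ->
      0 <= U -> 0 <= W -> 0 <= m ->
      (forall q : R, 0 <= q -> q <= t -> `|v q| <= U) ->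
      (forall q r : R, 0 < q -> q < r -> r <= t -> `|v r - v q| <= W * q `^ (- b) * (r - q) `^ b) ->
      (forall r q, 0 <= r -> r < q -> q <= t -> `|w q - w r| <= m * (q - r) `^ b') ->
      Vle ip e lam d (wint ip al 0 t (fun q y => S (t - q) (G (v q) y)) w)
        (C * m * (1 + U + W) * t `^ (b' - d))) ->
    Vle ip e lam d (wint ip al 0 (t - s)
      (fun q y => S (t - s - q) (G (phi q (theta s w) (phi s w x)) y)) (theta s w))
      (C * m * N * (t - s) `^ (b' - d)).
  move=> s0 st tT; apply=> //.
  - by rewrite subr_gt0.
  - move=> q q0 qt; rewrite -(sol_cocycle hphi)//; apply: hU.
      exact: addr_ge0.
    by apply: le_trans tT; rewrite -lerBrDr.
  - move=> q r q0 qr rt.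
    have r0 : 0 < r by exact: lt_trans qr.
    rewrite -!(sol_cocycle hphi) ?(ltW q0) ?(ltW r0)//.
    apply: le_trans (hW (q + s) (r + s) _ _ _) _; rewrite ?ltrD2r ?ltr_pwDl//.
      by apply: le_trans tT; rewrite -lerBrDr.
    rewrite (_ : r + s - (q + s) = r - q); last by ring.
    rewrite ler_wpM2r ?powR_ge0// ler_wpM2l// le_powRN ?lerDl//.
    exact/ltW/(lt_trans al0).
  - by apply: holder_le_theta => //; exact: holder_le_sub hw.
have w0 s t : 0 <= s -> s < t -> t <= T -> `|wint ip al 0 (t - s)
      (fun q y => S (t - s - q) (G (phi q (theta s w) (phi s w x)) y)) (theta s w)|
      <= C0 * m * N * (t - s) `^ b'.
  move=> s0 st tT; have := wbound 0 s t C0 s0 st tT hC0; rewrite subr0.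
  by apply: (Vle0_norm hip); rewrite !mulr_ge0 ?powR_ge0.
(* The extra 1 covers t = 0, where the value is [x] itself, without a lower bound on [MS]. *)
have UN : U <= (MS + 1) * `|x| + C0 * m * N * L.
  apply: minU => t t0 tT; have [->|tn0] := eqVneq t 0.
    rewrite (sol_zero hphi)// mulrDl mul1r -addrA [leRHS]addrCA lerDl.
    by rewrite addr_ge0// mulr_ge0// mulr_ge0// mulr_ge0.
  have tp : 0 < t by rewrite lt_neqAle eq_sym tn0 t0.
  rewrite (phi_shift x Ow T0 (lexx 0) tp tT) (sol_zero hphi)//.
  apply: le_trans (ler_normD _ _) _; apply: lerD.
    apply: le_trans (hMS _ _ _) _; first by rewrite subr0.
    by rewrite ler_wpM2r// lerDl.
  have := w0 0 t (lexx _) tp tT; rewrite (sol_zero hphi)// => /le_trans; apply.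
  by rewrite subr0 ler_wpM2l ?mulr_ge0// powL// gerBl (ltW (lt_trans al0 alb)).
have regular s : 0 < s -> s <= T ->
    Vle ip e lam b (phi s w x) (4 * s `^ (- b) * `|x| + Cb * m * N * s `^ (b' - b)).
  move=> s0 sT; have := wbound b 0 s Cb (lexx _) s0 sT hCb.
  rewrite (sol_zero hphi)// subr0 => h2.
  have := semigroup_smoothing hip heig hpos hS x s0 (d := b).
  move=> /(_ b01) h1; rewrite (phi_shift x Ow T0 (lexx 0) s0 sT) (sol_zero hphi)// subr0.
  exact: (Vle_add hip h1 h2).
have WN : W <= 4 * `|x| + (C0 + Cb) * m * N * L.
  apply: minW => s t s0 st tT.
  have sT : s <= T by exact: le_trans (ltW st) tT.
  have ts : 0 < t - s by rewrite subr_gt0.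
  rewrite (phi_shift x Ow T0 (ltW s0) st tT) addrAC.
  have h1 := w0 s t (ltW s0) st tT.
  have Rg0 : 0 <= 4 * s `^ (- b) * `|x| + Cb * m * N * s `^ (b' - b).
    by rewrite addr_ge0// !mulr_ge0 ?powR_ge0.
  have h2 := semigroup_sub_id hip heig hpos hS (ltW ts) b01 Rg0 (regular s s0 sT).
  (* The weight s^b cancels the singularity s^(-b) of the V_b bound; elsewhere it is at most 1. *)
  have Es : s `^ b * s `^ (- b) = 1 by rewrite -powR_add// subrr powRr0.
  have Et : (t - s) `^ b' = (t - s) `^ b * (t - s) `^ (b' - b).
    by rewrite -powR_add// (_ : b + (b' - b) = b')//; ring.
  have tsb : 0 < (t - s) `^ b by rewrite powR_gt0.
  rewrite mulrA ler_pdivrMr//.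
  apply: le_trans (_ : s `^ b * ((t - s) `^ b * (4 * s `^ (- b) * `|x| + Cb * m * N * s `^ (b' - b))
    + C0 * m * N * (t - s) `^ b') <= _).
    rewrite ler_wpM2l ?powR_ge0//.
    by apply: le_trans (ler_normD _ _) _; exact: lerD.
  rewrite Et [leLHS](_ : _ = (4 * (s `^ b * s `^ (- b)) * `|x| +
     (Cb * m * N * (s `^ b * s `^ (b' - b)) + C0 * m * N * (s `^ b * (t - s) `^ (b' - b)))) * (t - s) `^ b); last by ring.
  rewrite Es ler_wpM2r ?(ltW tsb)// mulr1 lerD2l.
  have s1 : s `^ b <= 1.
    rewrite -(powRr0 s) ger_powR ?(ltW (lt_trans al0 alb))// s0/=.
    exact: le_trans sT (le_trans Tl l1).
  have h3 p : 0 <= p -> p <= T -> s `^ b * p `^ (b' - b) <= L.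
    move=> p0 pT; apply: le_trans (_ : 1 * L <= _); last by rewrite mul1r.
    by rewrite ler_pM ?powR_ge0// powL.
  have h4 := h3 s (ltW s0) sT.
  have h5 : s `^ b * (t - s) `^ (b' - b) <= L.
    apply: h3 (ltW ts) _.
    by rewrite lerBlDr (le_trans tT)// lerDl ltW.
  rewrite [leRHS](_ : _ = Cb * m * N * L + C0 * m * N * L); last by ring.
  by rewrite lerD// ler_wpM2l// !mulr_ge0.
(* Absorption: the coefficient of N on the right is at most 1/2 by the choice of l. *)
have NN : N <= 2 * (MS + 5) * (1 + `|x|).
  have h6 : (2 * C0 + Cb) * m * N * L <= N * (1 / 2).
    rewrite [leLHS](_ : _ = N * ((2 * C0 + Cb) * m * L)); last by ring.
    by rewrite ler_wpM2l.
  have : N <= 1 + (MS + 5) * `|x| + (2 * C0 + Cb) * m * N * L.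
    rewrite [leRHS](_ : _ = 1 + ((MS + 1) * `|x| + C0 * m * N * L) +
      (4 * `|x| + (C0 + Cb) * m * N * L)); last by ring.
    by rewrite {1}/N -addrA -[leRHS]addrA lerD2l; exact: lerD.
  have := mulr_ge0 MS0 (normr_ge0 x).
  have := normr_ge0 x.
  lra.
move=> t t0 tT; apply: le_trans (hU t t0 tT) (le_trans _ NN).
by rewrite /N; lra.
Qed.

(** In terms of 1 + |x| the bound composes multiplicatively, so each piece of length l costs one
    factor [a], and finitely many pieces cover [0, 1]. *)
Lemma growth m : 0 <= m -> exists2 a, 1 <= a &
  forall w x T, Omega w -> T <= 1 -> holder_le w m T ->
  forall t, 0 <= t -> t <= T -> 1 + `|phi t w x| <= a * (1 + `|x|).
Proof.
move=> m0; have [l [C [l0 C0 hl]]] := local_growth m0.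
pose a := C + 1; have a1 : 1 <= a by rewrite /a lerDr.
have step n : forall w x T, Omega w -> T <= n%:R * l -> holder_le w m T ->
    forall t, 0 <= t -> t <= T -> 1 + `|phi t w x| <= a ^+ n * (1 + `|x|).
  elim: n => [|n IH] w x T Ow Tn hw t t0 tT.
    have -> : t = 0 by apply/le_anti; rewrite t0 (le_trans tT)// (le_trans Tn)// mul0r.
    by rewrite expr0 mul1r (sol_zero hphi).
  have [tl|/ltW lt] := leP t l.
    have [->|tn0] := eqVneq t 0.
      by rewrite (sol_zero hphi)// ler_peMl ?addr_ge0// exprn_ege1.
    have tp : 0 < t by rewrite lt_neqAle eq_sym tn0 t0.
    have := hl w x t Ow tp tl (holder_le_sub tT hw) t t0 (lexx _).
    move=> h; apply: le_trans (_ : a * (1 + `|x|) <= _).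
      by rewrite /a mulrDl mul1r [leLHS]addrC; apply: lerD => //; rewrite lerDl.
    rewrite ler_wpM2r ?addr_ge0// exprS ler_peMr ?exprn_ege1//.
    exact: le_trans a1.
  have E : phi t w x = phi (t - l) (theta l w) (phi l w x).
    by rewrite -(sol_cocycle hphi _ Ow) ?subr_ge0 ?(ltW l0)// subrK.
  rewrite E.
  have Tl : T - l <= n%:R * l by move: Tn; rewrite -natr1 mulrDl mul1r lerBlDr.
  have := IH (theta l w) (phi l w x) (T - l) (theta_Omega _ Ow) Tl
    (holder_le_theta (ltW l0) hw) (t - l).
  rewrite subr_ge0 lerD2r => /(_ lt tT) /le_trans; apply.
  rewrite exprSr -mulrA ler_wpM2l ?exprn_ge0 ?(le_trans ler01)//.
  have lT := le_trans lt tT.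
  have := hl w x l Ow l0 (lexx _) (holder_le_sub lT hw) l (ltW l0) (lexx _).
  move=> h; rewrite /a mulrDl mul1r [leLHS]addrC; apply: lerD => //.
  by rewrite lerDl.
exists (a ^+ (Num.trunc l^-1).+1) => [|w x T Ow T1]; first exact: exprn_ege1.
apply: step => //; apply: le_trans T1 _.
by rewrite -ler_pdivrMr// div1r ltW// truncnS_gt.
Qed.

End Growth.

(** * First passage of an increasing function *)

Section FirstPassage.
Context {R : realType}.
Implicit Types (f : R -> R) (m c p K x y eps : R).

(** At the infimum, continuity from the right gives m <= f c and from the left f c <= m. *)
Lemma first_passage f m : 0 < m -> f 0 < m -> m <= f 1 ->
  (forall x y, 0 <= x -> x < y -> f x < f y) ->
  (forall eps, 0 < eps -> exists2 del : R, 0 < del & forall x y, 0 <= x -> x < y -> y <= 1 ->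
     y - x <= del -> f y <= f x + eps) ->
  let c := inf [set t | 0 < t /\ m <= f t] in [/\ 0 < c, c <= 1 & f c = m].
Proof.
move=> m0 f0 f1 fmono fcont; set E := [set t | _] => c.
have E1 : E 1 by split.
have lbE : has_lbound E by exists 0 => x [/ltW].
have infE : has_inf E by split => //; exists 1.
have c0 : 0 <= c by apply: lb_le_inf; [exists 1|move=> x [/ltW]].
have c1 : c <= 1 by exact: ge_inf.
have mc : m <= f c.
  apply/ler_addgt0Pr => eps eps0; have [del del0 hdel] := fcont _ eps0.
  have [t [t0 mt] tc] := inf_adherent del0 infE.
  have ct : c <= t by apply: ge_inf.
  (* The modulus of continuity is available only up to 1, where level m is already reached. *)
  pose t' := Num.min t 1.
  have mt' : m <= f t' by rewrite /t' /Num.min; case: ifP.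
  have ct' : c <= t' by rewrite le_min ct c1.
  apply: le_trans mt' _; move: ct'; rewrite le_eqVlt => /predU1P[<-|ct'].
    by rewrite lerDl ltW.
  apply: hdel => //; first by rewrite ge_min lexx orbT.
  have : t' <= t by rewrite ge_min lexx.
  by lra.
have cp : 0 < c.
  rewrite lt_neqAle c0 andbT; apply/eqP => c00.
  by move: mc; rewrite -c00 leNgt f0.
split => //; apply/le_anti; rewrite mc andbT.
apply/ler_addgt0Pr => eps eps0; have [del del0 hdel] := fcont _ eps0.
(* A point within [del] to the left of c that is still positive, hence not yet past the level. *)
pose x := Num.max (c / 2) (c - del).
have x0 : 0 < x by rewrite lt_max divr_gt0.
have xc : x < c by rewrite gt_max; apply/andP; split; lra.
have fx : f x <= m.
  rewrite leNgt; apply/negP => /ltW mx; have : c <= x by apply: ge_inf.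
  by rewrite leNgt xc.
apply: le_trans (hdel x c (ltW x0) xc c1 _) _; last by rewrite lerD2r.
have : c - del <= x by rewrite le_max lexx orbT.
by lra.
Qed.

Lemma powR_small K p eps : 0 <= K -> 0 < p -> 0 < eps ->
  exists2 del : R, 0 < del & forall h, 0 < h -> h <= del -> K * h `^ p <= eps.
Proof.
move=> K0 p0 eps0; have K1 : 0 < K + 1 by lra.
have x0 : 0 < eps / (K + 1) by rewrite divr_gt0.
exists ((eps / (K + 1)) `^ p^-1) => [|h h0 hd]; first exact: powR_gt0.
apply: le_trans (_ : (K + 1) * (eps / (K + 1)) <= _).
  apply: ler_pM => //; [exact: powR_ge0|by rewrite lerDl|].
  apply: le_trans (_ : ((eps / (K + 1)) `^ p^-1) `^ p <= _).
    by rewrite ge0_ler_powR ?nnegrE ?powR_ge0 // ltW.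
  by rewrite -powRrM mulVf ?gt_eqF// powRr1// ltW.
by rewrite mulrC divfK// gt_eqF.
Qed.

(** The shares x / (x + y) and y / (x + y) lie in [0, 1], so each is at most its p-th power, and
    they sum to 1. *)
Lemma powR_subadd p x y : 0 <= p <= 1 -> 0 <= x -> 0 <= y ->
  (x + y) `^ p <= x `^ p + y `^ p.
Proof.
move=> /andP[p0 p1]; rewrite le_eqVlt => /predU1P[<-|x0].
  by rewrite add0r lerDr powR_ge0.
rewrite le_eqVlt => /predU1P[<-|y0]; first by rewrite addr0 lerDl powR_ge0.
have s0 : 0 < x + y by lra.
have h z : 0 < z -> z <= x + y -> z / (x + y) * (x + y) `^ p <= z `^ p.
  move=> z0 zs; rewrite -[in leRHS](divfK (lt0r_neq0 s0) z) powRM ?divr_ge0 ?(ltW z0) ?(ltW s0)//.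
  rewrite ler_wpM2r ?powR_ge0// ger1_powR// divr_gt0//=.
  by rewrite ler_pdivrMr// mul1r.
have := h x x0; have := h y y0; rewrite lerDl lerDr !(ltW x0, ltW y0) => /(_ isT) h1 /(_ isT) h2.
apply: le_trans (lerD h2 h1); rewrite -mulrDl -mulrDl divff ?mul1r//.
by rewrite gt_eqF.
Qed.

End FirstPassage.

(** * Stopping times as exact level passages *)

Section StoppingTimes.
Context {R : realType} {V : completeNormedModType R}.
Context (b' b'' mu : R) (w : R -> V).
Hypothesis hb : [/\ 0 < b', b' < 1, b' < b'' & 0 < mu].
Hypothesis hw : forall a c, a < c -> (hseminorm b'' w a c < +oo)%E.

Definition hs (a c : R) : R := fine (hseminorm b' w a c).

Lemma hseminorm_ub g a c s t : a <= s -> s < t -> t <= c ->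
  ((`|w t - w s| / (t - s) `^ g)%:E <= hseminorm g w a c)%E.
Proof. by move=> as_ st tc; apply: ereal_sup_ubound; exists s, t. Qed.

Lemma hseminorm_ge0 g a c : a < c -> (0 <= hseminorm g w a c)%E.
Proof.
move=> ac; apply: le_trans (hseminorm_ub g (lexx a) ac (lexx c)).
by rewrite lee_fin divr_ge0 ?powR_ge0.
Qed.

(** The surplus b'' - b' makes b'-quotients small on short intervals; from this comes the continuity
    of the seminorm in the endpoints. *)
Lemma local_holder a c : a < c -> exists2 K, 0 <= K & forall s t, a <= s -> s < t -> t <= c ->
  `|w t - w s| <= K * (t - s) `^ (b'' - b') * (t - s) `^ b'.
Proof.
move=> ac; have h0 := hseminorm_ge0 b'' ac.
exists (fine (hseminorm b'' w a c)) => [|s t as_ st tc]; first exact: fine_ge0.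
have ts : 0 < t - s by rewrite subr_gt0.
rewrite -mulrA -powR_add// subrK -ler_pdivrMr ?powR_gt0//.
rewrite -lee_fin fineK ?ge0_fin_numE ?hw//; exact: hseminorm_ub.
Qed.

Lemma hseminorm_hs a c : a < c -> hseminorm b' w a c = (hs a c)%:E.
Proof.
have [b'0 b'1 b'b'' mu0] := hb.
move=> ac; have [K K0 hK] := local_holder ac.
rewrite /hs fineK// ge0_fin_numE ?hseminorm_ge0//.
apply: le_lt_trans (ltry (K * (c - a) `^ (b'' - b'))).
apply: ge_ereal_sup => _ [s [t [as_ st tc ->]]]; rewrite lee_fin.
rewrite ler_pdivrMr ?powR_gt0 ?subr_gt0// (le_trans (hK s t as_ st tc))//.
rewrite ler_wpM2r ?powR_ge0// ler_wpM2l// ge0_ler_powR ?nnegrE; lra.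
Qed.

Lemma hs_ge0 a c : 0 <= hs a c.
Proof.
have [ac|ca] := ltP a c; first exact/fine_ge0/hseminorm_ge0.
(* For c <= a the supremum is over the empty set, and [fine] sends -oo to 0. *)
rewrite /hs /hseminorm (_ : mkset _ = set0) ?ereal_sup0//.
apply/seteqP; split => // x [s [t [h1 h2 h3 _]]].
by have := lt_le_trans (le_lt_trans h1 h2) h3; rewrite ltNge ca.
Qed.

Lemma hs_ub a c s t : a <= s -> s < t -> t <= c -> `|w t - w s| <= hs a c * (t - s) `^ b'.
Proof.
move=> as_ st tc; have ac : a < c by apply: lt_le_trans tc; exact: le_lt_trans st.
rewrite -ler_pdivrMr ?powR_gt0 ?subr_gt0// -lee_fin -hseminorm_hs//.
exact: hseminorm_ub.
Qed.

Lemma hs_le a c X : 0 <= X ->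
  (forall s t, a <= s -> s < t -> t <= c -> `|w t - w s| <= X * (t - s) `^ b') -> hs a c <= X.
Proof.
move=> X0 hX; have [ac|ca] := ltP a c.
  rewrite -lee_fin -hseminorm_hs//; apply: ge_ereal_sup => _ [s [t [as_ st tc ->]]].
  by rewrite lee_fin ler_pdivrMr ?powR_gt0 ?subr_gt0// hX.
rewrite /hs /hseminorm (_ : mkset _ = set0) ?ereal_sup0//.
apply/seteqP; split => // x [s [t [h1 h2 h3 _]]].
by have := lt_le_trans (le_lt_trans h1 h2) h3; rewrite ltNge ca.
Qed.

Lemma hs_self a : hs a a = 0.
Proof.
apply/le_anti; rewrite hs_ge0 andbT; apply: hs_le => // s t h1 h2 h3.
by have := lt_le_trans (le_lt_trans h1 h2) h3; rewrite ltxx.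
Qed.

Lemma hs_mono a c a' c' : a <= a' -> c' <= c -> hs a' c' <= hs a c.
Proof.
move=> aa' cc'; apply: hs_le (hs_ge0 _ _) _ => s t h1 h2 h3.
by apply: hs_ub => //; [exact: le_trans h1|exact: le_trans cc'].
Qed.

(** An increment across [c] is split there: one part is controlled by the seminorm of the kept
    interval, the other by the short added piece, and both lengths are below t - s. *)
Lemma hs_glue a0 c0 : a0 < c0 -> exists2 K, 0 <= K &
  forall a c c', a0 <= a -> a <= c -> c <= c' -> c' <= c0 ->
  hs a c' <= hs a c + K * (c' - c) `^ (b'' - b') /\
  hs a c' <= hs c c' + K * (c - a) `^ (b'' - b').
Proof.
have [b'0 b'1 b'b'' mu0] := hb.
move=> ac0; have [K K0 hK] := local_holder ac0; exists K => // a c c' a0a ac cc' c'c0.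
have pw x y p : 0 <= x -> x <= y -> 0 <= p -> x `^ p <= y `^ p.
  by move=> x0 xy p0; rewrite ge0_ler_powR// nnegrE//; exact: le_trans xy.
have loc s t z : a0 <= s -> s < t -> t <= c0 -> t - s <= z ->
    `|w t - w s| <= K * z `^ (b'' - b') * (t - s) `^ b'.
  move=> h1 h2 h3 h4; apply: le_trans (hK s t h1 h2 h3) _.
  by rewrite ler_wpM2r ?powR_ge0// ler_wpM2l// pw//; lra.
have sum s t X Y p q : 0 <= X -> 0 <= Y -> 0 <= p -> 0 <= q -> p <= t - s -> q <= t - s ->
    X * p `^ b' + Y * q `^ b' <= (X + Y) * (t - s) `^ b'.
  move=> X0 Y0 p0 q0 pt qt; rewrite mulrDl.
  by apply: lerD; rewrite ler_wpM2l// pw// ltW.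
split; (apply: hs_le; [by rewrite addr_ge0 ?hs_ge0// mulr_ge0 ?powR_ge0|]) => s t as_ st tc'.
- have [tc|ct] := leP t c.
    apply: le_trans (hs_ub as_ st tc) _.
    by rewrite ler_wpM2r ?powR_ge0// lerDl mulr_ge0 ?powR_ge0.
  have [cs|sc] := leP c s.
    apply: le_trans (loc s t (c' - c) _ _ _ _) _; try lra.
    by rewrite ler_wpM2r ?powR_ge0// lerDr hs_ge0.
  rewrite (_ : w t - w s = (w c - w s) + (w t - w c)); last by rewrite [RHS]addrC addrA subrK.
  apply: le_trans (ler_normD _ _) _.
  apply: le_trans (lerD (hs_ub as_ sc (lexx c)) (loc c t (c' - c) _ _ _ _)) _; try lra.
  by apply: sum; rewrite ?hs_ge0 ?mulr_ge0 ?powR_ge0//; lra.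
- have [tc|ct] := leP t c.
    apply: le_trans (loc s t (c - a) _ _ _ _) _; try lra.
    by rewrite ler_wpM2r ?powR_ge0// lerDr hs_ge0.
  have [cs|sc] := leP c s.
    apply: le_trans (hs_ub cs st tc') _.
    by rewrite ler_wpM2r ?powR_ge0// lerDl mulr_ge0 ?powR_ge0.
  rewrite (_ : w t - w s = (w t - w c) + (w c - w s)); last by rewrite addrA subrK.
  apply: le_trans (ler_normD _ _) _.
  apply: le_trans (lerD (hs_ub (lexx c) ct tc') (loc s c (c - a) _ _ _ _)) _; try lra.
  by apply: sum; rewrite ?hs_ge0 ?mulr_ge0 ?powR_ge0//; lra.
Qed.

(** The quantity in the definition of the stopping times, as a function of both ends, so that
    forward and backward times are read off the same expression. *)
Definition gain (a c : R) : R := hs a c + mu * (c - a) `^ (1 - b').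

Lemma gain_self a : gain a a = 0.
Proof.
have [b'0 b'1 b'b'' mu0] := hb.
by rewrite /gain hs_self subrr powR0 ?mulr0 ?addr0//; lra.
Qed.

Lemma gain_mono a c a' c' : a <= a' -> a' <= c' -> c' <= c -> c' - a' < c - a ->
  gain a' c' < gain a c.
Proof.
have [b'0 b'1 b'b'' mu0] := hb.
move=> h1 h2 h3 h4; apply: ler_ltD; first exact: hs_mono.
by rewrite ltr_pM2l// gt0_ltr_powR ?nnegrE//; lra.
Qed.

Lemma gain_unit a : mu <= gain a (a + 1).
Proof.
by rewrite /gain addrAC subrr add0r (powR1 R) mulr1 lerDr hs_ge0.
Qed.

Lemma gain_cont a0 c0 eps : a0 < c0 -> 0 < eps -> exists2 del, 0 < del &
  forall a c c', a0 <= a -> a <= c -> c <= c' -> c' <= c0 ->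
  (c < c' -> c' - c <= del -> gain a c' <= gain a c + eps) /\
  (a < c -> c - a <= del -> gain a c' <= gain c c' + eps).
Proof.
have [b'0 b'1 b'b'' mu0] := hb.
move=> ac0 eps0; have [K K0 hK] := hs_glue ac0.
have e2 : 0 < eps / 2 by lra.
have [|d1 d10 h1] := powR_small K0 _ e2 (p := b'' - b'); first by lra.
have [|d2 d20 h2] := powR_small (ltW mu0) _ e2 (p := 1 - b'); first by lra.
exists (Num.min d1 d2) => [|a c c' a0a ac cc' c'c0]; first by rewrite lt_min d10.
have [k1 k2] := hK a c c' a0a ac cc' c'c0.
have sub x y : 0 <= x -> 0 <= y -> mu * (x + y) `^ (1 - b') <= mu * x `^ (1 - b') + mu * y `^ (1 - b').
  by move=> x0 y0; rewrite -mulrDr ler_wpM2l ?(ltW mu0)// powR_subadd//; lra.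
split=> lt; rewrite le_min => /andP[ld1 ld2].
- have := h1 (c' - c); rewrite subr_gt0 => /(_ lt ld1) q1.
  have := h2 (c' - c); rewrite subr_gt0 => /(_ lt ld2) q2.
  have := sub (c - a) (c' - c); rewrite !subr_ge0 => /(_ ac cc').
  rewrite (_ : c - a + (c' - c) = c' - a); last by ring.
  by rewrite /gain; lra.
- have := h1 (c - a); rewrite subr_gt0 => /(_ lt ld1) q1.
  have := h2 (c - a); rewrite subr_gt0 => /(_ lt ld2) q2.
  have := sub (c' - c) (c - a); rewrite !subr_ge0 => /(_ cc' ac).
  rewrite (_ : c' - c + (c - a) = c' - a); last by ring.
  by rewrite /gain; lra.
Qed.

(** One relation for both directions: the forward time from [a] and the backward time from [c] each
    produce such an interval. *)
Definition next_stop (a c : R) : Prop := a < c /\ gain a c = mu.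

Lemma hseminorm_theta g a x y : hseminorm g (theta a w) x y = hseminorm g w (a + x) (a + y).
Proof.
rewrite /hseminorm; congr ereal_sup; apply/seteqP; split => z [s [t [h1 h2 h3 ->]]].
  exists (a + s), (a + t); split; rewrite ?lerD2l ?ltrD2l//.
  by rewrite /theta opprB addrA subrK (_ : a + t - (a + s) = t - s)//; ring.
exists (s - a), (t - a); split; rewrite ?lerBrDl ?ltrD2r ?lerBlDl//.
by rewrite /theta !subrKC opprB addrA subrK (_ : t - a - (s - a) = t - s)//; ring.
Qed.

Lemma stop_next a : next_stop a (a + stop b' mu (theta a w)) /\ stop b' mu (theta a w) <= 1.
Proof.
have [b'0 b'1 b'b'' mu0] := hb.
pose f x := gain a (a + x).
have [||||c0 c1 fc] := @first_passage R f mu mu0.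
- by rewrite /f addr0 gain_self.
- exact: gain_unit.
- by move=> x y x0 xy; apply: gain_mono => //; lra.
- move=> eps eps0; have aa : a < a + 1 by lra.
  have [del del0 h] := gain_cont aa eps0.
  exists del => // x y x0 xy y1 yx.
  have [||||+ _] := h a (a + x) (a + y); try lra.
  by apply; lra.
suff E : stop b' mu (theta a w) = inf [set t | 0 < t /\ mu <= f t].
  by rewrite E; split => //; split; rewrite ?ltrDl.
congr inf; apply/seteqP; split => x /= [x0]; rewrite hseminorm_theta addr0 hseminorm_hs ?ltrDl//;
  by rewrite -EFinD lee_fin /f /gain addrAC subrr add0r.
Qed.

Lemma stop_back_next c : next_stop (c + stop_back b' mu (theta c w)) c.
Proof.
have [b'0 b'1 b'b'' mu0] := hb.
pose f x := gain (c - x) c.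
have [||||x0 x1 fx] := @first_passage R f mu mu0.
- by rewrite /f subr0 gain_self.
- by have := gain_unit (c - 1); rewrite subrK.
- by move=> x y x0 xy; apply: gain_mono => //; lra.
- move=> eps eps0; have aa : c - 1 < c by lra.
  have [del del0 h] := gain_cont aa eps0.
  exists del => // x y xx xy y1 yx.
  have [||||_ +] := h (c - y) (c - x) c; try lra.
  by apply; lra.
suff E : stop_back b' mu (theta c w) = - inf [set t | 0 < t /\ mu <= f t].
  by rewrite E; split => //; rewrite ltrBlDr ltrDl.
(* [inf] is minus the supremum of the reflected set, and that reflected set is the one defining
   [stop_back]. *)
rewrite /inf opprK; congr sup; apply/seteqP; split => x /=.
  move=> [x0']; rewrite hseminorm_theta addr0 hseminorm_hs; last by lra.
  rewrite -EFinD lee_fin ltr0_norm// => h; exists (- x); last by rewrite opprK.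
  by rewrite oppr_gt0; split => //; rewrite /f /gain opprK opprD addNKr.
move=> [t [t0 mt] <-]; rewrite oppr_lt0; split => //.
rewrite hseminorm_theta addr0 hseminorm_hs; last by lra.
rewrite -EFinD lee_fin normrN gtr0_norm//; move: mt.
by rewrite /f /gain (_ : c - (c - t) = t)//; ring.
Qed.

(** Intervals of equal gain are never properly nested, by strict monotonicity. Monotonicity and
    invertibility of the successor map both follow. *)
Lemma next_stop_le a c a' c' : next_stop a c -> next_stop a' c' -> (a <= a') = (c <= c').
Proof.
move=> [ac g1] [ac' g2]; apply/idP/idP => h.
- rewrite leNgt; apply/negP => cc'.
  by have := gain_mono h (ltW ac') (ltW cc'); rewrite g1 g2 ltxx => /(_ _)/negP; apply; lra.
- rewrite leNgt; apply/negP => aa'.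
  by have := gain_mono (ltW aa') (ltW ac) h; rewrite g1 g2 ltxx => /(_ _)/negP; apply; lra.
Qed.

End StoppingTimes.

(** * Exponential growth rates of radii *)

Section Tempered.
Context {R : realType}.
Implicit Types (r u : nat -> R) (nu x y A : R).

Lemma limn_esup_lt u nu : (limn_esup (fun n => (u n)%:E) < nu%:E)%E ->
  exists nu' n0, nu' < nu /\ forall n, (n0 <= n)%N -> u n <= nu'.
Proof.
move=> /ereal_inf_lt [_ [A [n0 _ nA] <-]] hA.
have ub n : (n0 <= n)%N -> ((u n)%:E <= ereal_sup [set (u x)%:E | x in A])%E.
  by move=> n0n; apply: ereal_sup_ubound; exists n => //; exact: nA.
have fin : ereal_sup [set (u x)%:E | x in A] \is a fin_num.
  rewrite fin_numElt (lt_trans hA) ?ltry// andbT.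
  by apply: lt_le_trans (ub n0 (leqnn _)); exact: ltNyr.
exists (fine (ereal_sup [set (u x)%:E | x in A])), n0; split=> [|n n0n].
  by rewrite -lte_fin fineK.
by rewrite -lee_fin fineK// ub.
Qed.

Lemma limn_esup_le u nu n0 : (forall n, (n0 <= n)%N -> u n <= nu) ->
  (limn_esup (fun n => (u n)%:E) <= nu%:E)%E.
Proof.
move=> h; apply: le_trans (_ : (ereal_sup [set (u x)%:E | x in [set n | (n0 <= n)%N]] <= _)%E).
  by apply: ereal_inf_lbound; exists [set n | (n0 <= n)%N] => //; exists n0.
by apply: ge_ereal_sup => _ [n /= n0n <-]; rewrite lee_fin h.
Qed.

Lemma logplus_ge0 x : 0 <= logplus x.
Proof. by rewrite /logplus le_max lexx orbT. Qed.

Lemma logplus_max x : logplus x = ln (Num.max x 1).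
Proof.
rewrite /logplus; have [x1|x1] := leP x 1.
  by rewrite ln1; apply/max_idPr; exact: ln_le0.
by apply/max_idPl; rewrite ln_ge0// ltW.
Qed.

Lemma logplus_affine A x : 1 <= A -> logplus (A * (1 + x)) <= ln (2 * A) + logplus x.
Proof.
move=> A1; rewrite !logplus_max.
have m1 : 1 <= Num.max x 1 by rewrite le_max lexx orbT.
have mx : x <= Num.max x 1 by rewrite le_max lexx.
rewrite -lnM ?posrE; try lra.
rewrite ler_ln ?posrE; last 2 first.
- by rewrite lt_max ltr01 orbT.
- by apply: mulr_gt0; lra.
rewrite ge_max; apply/andP; split.
  rewrite (mulrC 2) -mulrA ler_wpM2l; lra.
by rewrite -[leLHS]mulr1 ler_pM//; lra.
Qed.

Lemma logplus_le_expR x y : logplus x <= y -> x <= expR y.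
Proof.
rewrite logplus_max => h; apply: le_trans (_ : Num.max x 1 <= _); first by rewrite le_max lexx.
by rewrite -(@lnK _ (Num.max x 1)) ?posrE ?lt_max ?ltr01 ?orbT// ler_expR.
Qed.

Lemma logplus_expR y : 0 <= y -> logplus (expR y) = y.
Proof. by move=> y0; rewrite /logplus expRK; apply/max_idPl. Qed.

(** The condition limsup < nu with the slack nu - nu' made explicit and the division by n
    cleared. *)
Definition tempered nu r := exists nu' n0, [/\ 0 <= nu', nu' < nu &
  forall n, (n0 <= n)%N -> logplus (r n) <= nu' * n%:R].

Lemma tempered_of_limsup nu r :
  (limn_esup (fun n => (logplus (r n) / n%:R)%:E) < nu%:E)%E -> tempered nu r.
Proof.
move=> /(@limn_esup_lt (fun n => logplus (r n) / n%:R)) [nu' [n0 [nn hn]]].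
(* The successor excludes n = 0, where division by 0 gives 0 and carries no information. *)
exists nu', n0.+1; split => // [|n n0n].
  by apply: le_trans (hn n0 (leqnn _)); rewrite divr_ge0 ?logplus_ge0.
have n1 : 0 < n%:R :> R by rewrite ltr0n; exact: leq_trans n0n.
by rewrite -ler_pdivrMr// hn// ltnW.
Qed.

Lemma limsup_of_tempered nu r : tempered nu r ->
  (limn_esup (fun n => (logplus (r n) / n%:R)%:E) < nu%:E)%E.
Proof.
move=> [nu' [n0 [nu0 nn hn]]]; apply: (@le_lt_trans _ _ nu'%:E); last by rewrite lte_fin.
apply: (@limn_esup_le (fun n => logplus (r n) / n%:R) _ n0.+1) => n n0n.
have n1 : 0 < n%:R :> R by rewrite ltr0n; exact: leq_trans n0n.
by rewrite ler_pdivrMr// hn// ltnW.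
Qed.

(** The affine map and the index shift add only a constant to the logarithm, absorbed for large n by
    half of the slack nu - nu'. *)
Lemma tempered_affine nu r A q : 1 <= A -> tempered nu r ->
  tempered nu (fun n => A * (1 + r (n + q)%N)).
Proof.
move=> A1 [nu' [n0 [nu0 nn hn]]].
pose c := ln (2 * A) + nu' * q%:R.
have h : 0 < (nu - nu') / 2 by lra.
exists ((nu' + nu) / 2), (maxn n0 (Num.trunc (c / ((nu - nu') / 2))).+1); split; try lra.
move=> n; rewrite geq_max => /andP[n0n hc].
apply: le_trans (logplus_affine _ A1) _.
have h1 := hn (n + q)%N (leq_trans n0n (leq_addr _ _)).
have h2 : c <= (nu - nu') / 2 * n%:R.
  rewrite -ler_pdivrMl// mulrC ltW// (lt_le_trans (truncnS_gt _))// ler_nat.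
  exact: hc.
move: h1 h2; rewrite /c natrD mulrDr; set L := ln _; set Y := logplus _ => h1 h2.
have -> : (nu' + nu) / 2 * n%:R = nu' * n%:R + (nu - nu') / 2 * n%:R by field.
by lra.
Qed.

End Tempered.

(** * The Hausdorff semidistance *)

Section Hausdorff.
Context {R : realType} {V : completeNormedModType R}.
Implicit Types X Y Z : set V.

Lemma hdist_ge0 X Y : X !=set0 -> (0 <= hdist X Y)%E.
Proof.
move=> [x Xx]; apply: le_trans (_ : (ereal_inf [set (`|x - y|)%:E | y in Y] <= _)%E).
  by apply: le_ereal_inf_tmp => _ [y _ <-]; rewrite lee_fin.
by apply: ereal_sup_ubound; exists x.
Qed.

Lemma hdist_sub X X' Y : X `<=` X' -> (hdist X Y <= hdist X' Y)%E.
Proof.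
move=> XX; apply: ge_ereal_sup => _ [x Xx <-].
by apply: ereal_sup_ubound; exists x => //; exact: XX.
Qed.

Lemma hdist0_sub X Y : compact Y -> (hdist X Y <= 0)%E -> X `<=` Y.
Proof.
move=> cY h x Xx.
have clY : closed Y by apply: compact_closed => //; exact: norm_hausdorff.
apply: clY => B /nbhs_ballP [eps /= eps0 hB].
have : (ereal_inf [set (`|x - y|)%:E | y in Y] < eps%:E)%E.
  apply: (@le_lt_trans _ _ 0%E); last by rewrite lte_fin.
  by apply: le_trans h; apply: ereal_sup_ubound; exists x.
move=> /ereal_inf_lt [_ [y Yy <-]]; rewrite lte_fin => xy.
by exists y; split => //; apply: hB; rewrite -ball_normE.
Qed.

End Hausdorff.

(** * Composition of path shifts *)

Section Shift.
Context {R : realType} {V : completeNormedModType R}.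

Lemma theta_add (s t : R) (w : R -> V) : theta s (theta t w) = theta (t + s) w.
Proof. by apply/funext => r; rewrite /theta opprB addrA subrK addrA. Qed.

Lemma theta0 (w : R -> V) : w 0 = 0 -> theta 0 w = w.
Proof. by move=> w0; apply/funext => r; rewrite /theta w0 subr0 add0r. Qed.

End Shift.

(** * Stopping sequences in the absolute time of one path *)

Section StopSequence.
Context {R : realType} {V : completeNormedModType R}.
Context (b' b'' mu : R) (w : R -> V).
Hypothesis hb : [/\ 0 < b', b' < 1, b' < b'' & 0 < mu].
Hypothesis hw : forall a c, a < c -> (hseminorm b'' w a c < +oo)%E.

Definition succ_stop (a : R) : R := a + stop b' mu (theta a w).
Definition pred_stop (a : R) : R := a + stop_back b' mu (theta a w).

Lemma succ_stopP a : next_stop b' mu w a (succ_stop a).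
Proof. by have [] := stop_next hb hw a. Qed.

Lemma pred_stopP a : next_stop b' mu w (pred_stop a) a.
Proof. exact: (stop_back_next hb hw). Qed.

(** Both sides close an interval of gain mu opened at [pred_stop a], and such a right end is
    unique. *)
Lemma succ_pred a : succ_stop (pred_stop a) = a.
Proof.
apply/le_anti; rewrite -(next_stop_le hb hw (succ_stopP _) (pred_stopP a)).
by rewrite -(next_stop_le hb hw (pred_stopP a) (succ_stopP _)) lexx.
Qed.

Lemma succ_stop_le a c : (succ_stop a <= succ_stop c) = (a <= c).
Proof. by rewrite -(next_stop_le hb hw (succ_stopP a) (succ_stopP c)). Qed.

Lemma pred_stop_le a c : (pred_stop a <= pred_stop c) = (a <= c).
Proof. by rewrite (next_stop_le hb hw (pred_stopP a) (pred_stopP c)). Qed.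

Lemma iter_succ_le n a c : (iter n succ_stop a <= iter n succ_stop c) = (a <= c).
Proof. by elim: n => [//|n IH] /=; rewrite succ_stop_le. Qed.

Lemma iter_pred_le n a c : (iter n pred_stop a <= iter n pred_stop c) = (a <= c).
Proof. by elim: n => [//|n IH] /=; rewrite pred_stop_le. Qed.

Lemma iter_succ_pred n k a : iter n succ_stop (iter (k + n) pred_stop a) = iter k pred_stop a.
Proof.
elim: n => [|n IH]; first by rewrite addn0.
by rewrite addnS iterSr /= succ_pred.
Qed.

Lemma pred_stop_lt a : pred_stop a < a.
Proof. by have [] := pred_stopP a. Qed.

Lemma succ_stop_gt a : a < succ_stop a.
Proof. by have [] := succ_stopP a. Qed.

Lemma succ_stop_le1 a : succ_stop a <= a + 1.
Proof. by have [_] := stop_next hb hw a; rewrite /succ_stop lerD2l. Qed.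

Lemma pred_stop_ge1 a : a - 1 <= pred_stop a.
Proof. by rewrite lerBlDr -[leLHS]succ_pred succ_stop_le1. Qed.

(** Each step has length at most 1; this converts growth rates in time into rates in the index. *)
Lemma iter_pred_ge n a : a - n%:R <= iter n pred_stop a.
Proof.
elim: n => [|n IH]; first by rewrite subr0.
apply: le_trans (pred_stop_ge1 _).
by rewrite -natr1 opprD addrA lerD2r.
Qed.

Lemma iter_pred_mono n a : iter n.+1 pred_stop a <= iter n pred_stop a.
Proof. exact/ltW/pred_stop_lt. Qed.

Lemma iter_pred_top n a : iter n pred_stop a <= a.
Proof. by elim: n => [//|n IH]; exact: le_trans (iter_pred_mono _ _) IH. Qed.

Lemma stop_pos_theta n a : a + stop_pos b' mu (theta a w) n = iter n succ_stop a.
Proof.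
elim: n => [|n IH]; first by rewrite /= addr0.
by rewrite /= theta_add addrA IH.
Qed.

Lemma stop_neg_theta n a : a + stop_neg b' mu (theta a w) n = iter n pred_stop a.
Proof.
elim: n => [|n IH]; first by rewrite /= addr0.
by rewrite /= theta_add addrA IH.
Qed.

Lemma Tstop_neg_theta n a : Tstop b' mu (- n%:Z) (theta a w) = iter n pred_stop a - a.
Proof.
rewrite -stop_neg_theta addrAC subrr add0r.
(* The integer - n is [Posz 0] for n = 0 and a [Negz] otherwise, which selects the branch of
   [Tstop]. *)
by case: n.
Qed.

Lemma Phi_theta (phi : R -> (R -> V) -> V -> V) i n a u :
  Phi b' mu phi i (- n%:Z) (theta a w) u =
  phi (iter i succ_stop (iter n pred_stop a) - iter n pred_stop a)
      (theta (iter n pred_stop a) w) u.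
Proof.
rewrite /Phi Tstop_neg_theta theta_add addrC subrK /=.
by rewrite -stop_pos_theta addrAC subrr add0r.
Qed.

(** At the stop, the seminorm is one of two nonnegative summands of [gain], whose value is mu. *)
Lemma holder_le_stop a : holder_le b' (theta a w) mu (succ_stop a - a).
Proof.
have [b'0 b'1 b'b'' mu0] := hb.
have [lt g] := succ_stopP a.
move=> r q r0 rq qs; rewrite /theta opprB addrA subrK.
have := hs_ub hb hw (a := a) (c := succ_stop a) (s := a + r) (t := a + q).
rewrite lerDl ltrD2l -lerBrDl => /(_ r0 rq qs) h; apply: le_trans h _.
rewrite (_ : a + q - (a + r) = q - r); last by ring.
apply: ler_wpM2r; first exact: powR_ge0.
by rewrite -[leRHS]g /gain lerDl mulr_ge0 ?powR_ge0// ltW.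
Qed.

End StopSequence.

(** * Transport of the discrete attractors along the flow *)

Section Comparison.
Context {R : realType} {V : completeNormedModType R}.
Context (b' b'' mu nu d : R) (Omega : set (R -> V)) (phi : R -> (R -> V) -> V -> V).
Context (Aj : int -> (R -> V) -> set V).
Hypothesis hb : [/\ 0 < b', b' < 1, b' < b'' & 0 < mu].
Hypothesis hOmega : path_space b'' Omega.
Hypothesis phi0 : forall w u, Omega w -> phi 0 w u = u.
Hypothesis phi_add : forall w u s t, Omega w -> 0 <= t -> 0 <= s ->
  phi (t + s) w u = phi t (theta s w) (phi s w u).
Hypothesis hA : forall w, Omega w ->
  pullback_attractor nu (fun i j => Phi b' mu phi i j w) (fun i => Aj i w).
Hypothesis d0 : 0 < d.
Hypothesis hT : forall w, Omega w ->
  (d%:E <= limn_einf (fun n : nat => (`|Tstop b' mu (- n%:Z) w| / n%:R)%:E))%E.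
Hypothesis nu0 : 0 < nu.
Context (K : R).
Hypothesis K1 : 1 <= K.
Hypothesis grow : forall w x T, Omega w -> T <= 1 -> holder_le b' w mu T ->
  forall t, 0 <= t -> t <= T -> 1 + `|phi t w x| <= K * (1 + `|x|).

Let theta_Omega t w : Omega w -> Omega (theta t w).
Proof. by have [_ _ h] := hOmega => Ow; exact: h. Qed.

Let finite_b'' w : Omega w -> forall a c, a < c -> (hseminorm b'' w a c < +oo)%E.
Proof. by have [_ h _] := hOmega => Ow; exact: h. Qed.

Let theta0_Omega w : Omega w -> theta 0 w = w.
Proof. by have [h _ _] := hOmega => Ow; apply: theta0; exact: h. Qed.

(** The cocycle as a two-parameter process in the absolute time of [w], so that orbit pieces
    belonging to different shifts compose. *)
Let flow w s t := phi (t - s) (theta s w).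

Let flow_trans w r s t u : Omega w -> r <= s -> s <= t ->
  flow w s t (flow w r s u) = flow w r t u.
Proof.
move=> Ow rs st; rewrite /flow (_ : t - r = (t - s) + (s - r)); last by ring.
rewrite [RHS]phi_add ?subr_ge0//; last exact: theta_Omega.
by rewrite theta_add subrKC.
Qed.

(** Steps are counted along the successor orbit of [a] itself, so each lies in a stopping interval
    from its left end, where the Hoelder constant is at most mu. *)
Lemma growth_steps w q a c u : Omega w -> a <= c -> c <= iter q (succ_stop b' mu w) a ->
  1 + `|flow w a c u| <= K ^+ q * (1 + `|u|).
Proof.
move=> Ow; have fin := finite_b'' Ow.
elim: q a u => [|q IH] a u ac ca.
  have -> : c = a by apply/le_anti; rewrite ac ca.
  by rewrite /flow subrr phi0 ?expr0 ?mul1r//; exact: theta_Omega.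
have stepw c' : a <= c' -> c' <= succ_stop b' mu w a -> 1 + `|flow w a c' u| <= K * (1 + `|u|).
  move=> ac' ca'; apply: (grow _ (theta_Omega a Ow) (T := succ_stop b' mu w a - a)).
  - by have := succ_stop_le1 hb fin a; lra.
  - exact: (holder_le_stop hb fin).
  - by rewrite subr_ge0.
  - by rewrite lerD2r.
have [cs|/ltW sc] := leP c (succ_stop b' mu w a).
  apply: le_trans (stepw c ac cs) _; rewrite ler_wpM2r ?addr_ge0// exprS.
  by rewrite ler_peMr ?exprn_ege1// (le_trans ler01).
have as_ := ltW (succ_stop_gt hb fin a).
rewrite -(flow_trans u Ow as_ sc).
apply: le_trans (IH (succ_stop b' mu w a) _ sc _) _; first by rewrite -iterSr.
rewrite exprSr -mulrA ler_wpM2l ?exprn_ge0 ?(le_trans ler01)//.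
exact: stepw.
Qed.

(** A lower limit at least d > 0 makes the n-th backward stopping time exceed n d / 2 in modulus for
    large n; halving d gives the strict inequality. *)
Lemma pred_stop_unbounded w t M : Omega w -> exists q, iter q (pred_stop b' mu w) t <= M.
Proof.
move=> Ow; have fin := finite_b'' Ow.
have dp := d0; have := hT (theta_Omega t Ow); rewrite /limn_einf leeNr -EFinN.
set L := limn_esup _ => hL.
have {hL} : (L < (- (d / 2))%:E)%E by apply: le_lt_trans hL _; rewrite lte_fin ltrN2; lra.
rewrite /L; under [X in limn_esup X]eq_fun do rewrite -EFinN.
move=> /limn_esup_lt [nu' [n0 [nn hn]]].
pose n := maxn n0.+1 (Num.trunc ((t - M) / (d / 2))).+1.
have n0n : (n0 <= n)%N by rewrite (leq_trans (leqnSn n0))// leq_maxl.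
have n1 : 0 < n%:R :> R by rewrite ltr0n (leq_trans _ (leq_maxl _ _)).
exists n; have := hn n n0n; rewrite Tstop_neg_theta.
rewrite distrC ger0_norm; last by rewrite subr_ge0 (iter_pred_top hb fin).
move=> h1; have : d / 2 < (t - iter n (pred_stop b' mu w) t) / n%:R by lra.
rewrite ltr_pdivlMr// => h2.
have h3 : (t - M) <= d / 2 * n%:R.
  rewrite mulrC -ler_pdivrMr; last by lra.
  apply: le_trans (ltW (truncnS_gt _)) _; rewrite ler_nat; exact: leq_maxr.
by lra.
Qed.

Lemma attract w t (B : nat -> set V) (r : nat -> R) : Omega w ->
  (forall n, B n !=set0) -> (forall n x, B n x -> `|x| <= r n) -> tempered nu r ->
  hdist (flow w (iter n (pred_stop b' mu w) t) t @` B n) (Aj 0 (theta t w))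
    @[n --> \oo] --> 0%E.
Proof.
move=> Ow B0 Br tr; have fin := finite_b'' Ow.
(* The family must be indexed by all integers; nonnegative indices reuse index 0, and the limits
   only see the indices - n. *)
pose idx (i : int) : nat := if i is Negz n then n.+1 else 0%N.
have idxN n : idx (- n%:Z) = n by case: n.
have DZB : DZ nu (fun i => B (idx i)).
  split => //; exists (fun i => r (idx i)); split.
    by move=> i x; exact: Br.
  have := limsup_of_tempered tr; rewrite (_ : (fun n => _) =
    (fun n : nat => (logplus (r (idx (- n%:Z))) / n%:R)%:E))//.
  by apply/funext => n; rewrite idxN.
have := attr_attracts (hA (theta_Omega t Ow)) 0 DZB.
rewrite (_ : (fun n => hdist _ _) = (fun n => hdist (flow w (iter n (pred_stop b' mu w) t) t @` B n) (Aj 0 (theta t w))))//.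
apply/funext => n; rewrite sub0r idxN; congr (hdist (_ @` _) _).
apply/funext => u; rewrite Phi_theta.
by have := iter_succ_pred hb fin n 0 t; rewrite add0n /= => ->.
Qed.

(** [X] is fixed while the semidistances tend to 0, so [X] has semidistance 0 to a compact set. *)
Lemma absorbed w t (X : set V) (B : nat -> set V) (r : nat -> R) : Omega w ->
  (forall n, B n !=set0) -> (forall n x, B n x -> `|x| <= r n) -> tempered nu r ->
  (forall n, X `<=` flow w (iter n (pred_stop b' mu w) t) t @` B n) ->
  X `<=` Aj 0 (theta t w).
Proof.
move=> Ow B0 Br tr XB; have cv := @attract w t B r Ow B0 Br tr.
apply: hdist0_sub; first exact: attr_compact (hA (theta_Omega t Ow)) 0.
have : (hdist X (Aj 0 (theta t w)) <= limn (fun n =>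
    hdist (flow w (iter n (pred_stop b' mu w) t) t @` B n) (Aj 0 (theta t w))))%E.
  apply: lime_ge; first by apply/cvg_ex; exists 0%E.
  by apply: nearW => n; exact: hdist_sub.
by rewrite (cvg_lim _ cv).
Qed.

Lemma attractor_tempered w : Omega w -> exists2 r, tempered nu r &
  forall n x, Aj (- n%:Z) w x -> `|x| <= r n.
Proof.
move=> Ow; have [_ [r [hr limr]]] := attr_DZ (hA Ow).
exists (fun n => r (- n%:Z)); last by move=> n x; exact: hr.
exact: tempered_of_limsup.
Qed.

Lemma flow_attractor w t k n : Omega w ->
  flow w (iter (k + n) (pred_stop b' mu w) t) (iter k (pred_stop b' mu w) t) @`
     Aj (- (k + n)%:Z) (theta t w) = Aj (- k%:Z) (theta t w).
Proof.
move=> Ow; have fin := finite_b'' Ow.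
have := attr_invariant (hA (theta_Omega t Ow)) n (- (k + n)%:Z).
rewrite (_ : n%:Z - (k + n)%:Z = - k%:Z); last by rewrite PoszD opprD addrCA subrr addr0.
move=> <-; congr (_ @` _); apply/funext => u; rewrite Phi_theta.
by rewrite (iter_succ_pred hb fin).
Qed.

Lemma attractor_nonempty w i : Omega w -> Aj i w !=set0.
Proof. by move=> Ow; have [h _] := attr_DZ (hA Ow). Qed.

Lemma tempered_image w (s t : nat -> R) q p r (B : nat -> set V) :
  Omega w -> tempered nu r -> (forall n x, B n x -> `|x| <= r (n + p)%N) ->
  (forall n, s n <= t n) -> (forall n, t n <= iter q (succ_stop b' mu w) (s n)) ->
  exists2 r', tempered nu r' & forall n x, (flow w (s n) (t n) @` B n) x -> `|x| <= r' n.
Proof.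
move=> Ow tr Br st ts; exists (fun n => K ^+ q * (1 + r (n + p)%N)).
  by apply: tempered_affine => //; exact: exprn_ege1.
move=> n _ [u Bu <-]; apply: le_trans (_ : 1 + `|flow w (s n) (t n) u| <= _).
  by rewrite lerDr.
apply: le_trans (growth_steps u Ow (st n) (ts n)) _.
by rewrite ler_wpM2l ?exprn_ge0 ?(le_trans ler01)// lerD2l Br.
Qed.

Lemma attractor_flow w t : 0 <= t -> Omega w -> phi t w @` Aj 0 w = Aj 0 (theta t w).
Proof.
move=> t0 Ow; have fin := finite_b'' Ow.
pose x n := iter n (pred_stop b' mu w) 0.
pose y n := iter n (pred_stop b' mu w) t.
(* One q serves for all n: the q-th predecessor of t lies left of 0, and the predecessor map is
   monotone. *)
have [q yq] := pred_stop_unbounded t 0 Ow.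
have xy n : x n <= y n by rewrite (iter_pred_le hb fin).
have yx n : y (n + q)%N <= x n.
  by rewrite /y iterD (iter_pred_le hb fin).
have x_le n : x n <= 0 by exact: (iter_pred_top hb fin).
have y_le n : y n <= t by exact: (iter_pred_top hb fin).
have phiE : phi t w = flow w 0 t by rewrite /flow subr0 theta0_Omega.
have A0E : Aj 0 w = Aj 0 (theta 0 w) by rewrite theta0_Omega.
have flow_x n k : flow w (x (k + n)%N) (x k) @` Aj (- (k + n)%:Z) w = Aj (- k%:Z) w.
  by have := flow_attractor 0 k n Ow; rewrite theta0_Omega.
have flow_y n k : flow w (y (k + n)%N) (y k) @` Aj (- (k + n)%:Z) (theta t w) =
    Aj (- k%:Z) (theta t w) by exact: flow_attractor.
apply/seteqP; split.
- have [r tr Ar] := attractor_tempered Ow.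
  have [|||r' tr' Br'] := @tempered_image w x y q 0 r (fun n => Aj (- n%:Z) w) Ow tr.
  + by move=> n u Au; rewrite addn0; exact: Ar.
  + exact: xy.
  + move=> n; rewrite -[y n](iter_succ_pred hb fin q n t) (iter_succ_le hb fin).
    exact: yx.
  apply: (absorbed Ow _ Br' tr') => [n|n].
    by have [u Au] := attractor_nonempty (- n%:Z) Ow; exists (flow w (x n) (y n) u); exists u.
  move=> _ [u Au <-]; move: Au; rewrite -{1}(flow_x n 0%N) add0n => -[v Av <-].
  exists (flow w (x n) (y n) v); first by exists v.
  rewrite (flow_trans v Ow (xy n) (y_le n)) phiE.
  by rewrite (flow_trans v Ow (x_le n) t0).
- have Ot := theta_Omega t Ow.
  have [r tr Ar] := attractor_tempered Ot.
  have [|||r' tr' Br'] := @tempered_image w (fun n => y (n + q)%N) x q q r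
     (fun n => Aj (- (n + q)%:Z) (theta t w)) Ow tr.
  + by move=> n u; exact: Ar.
  + exact: yx.
  + by move=> n; rewrite (iter_succ_pred hb fin).
  (* The stop y q precedes both 0 and t. The attractor of the shifted path at index - q is carried
     first to time 0, where A(w) absorbs it, and then to t, where invariance identifies its
     image. *)
  have sub : flow w (y q) 0 @` Aj (- q%:Z) (theta t w) `<=` Aj 0 w.
    rewrite A0E; apply: (absorbed Ow _ Br' tr') => [n|n].
      have [u Au] := attractor_nonempty (- (n + q)%:Z) Ot.
      by exists (flow w (y (n + q)%N) (x n) u); exists u.
    move=> _ [u Au <-]; move: Au; rewrite -(flow_y n q) addnC => -[v Av <-].
    exists (flow w (y (n + q)%N) (x n) v); first by exists v.
    have yy : y (n + q)%N <= y q.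
      by rewrite /y iterD (iter_pred_top hb fin).
    by rewrite (flow_trans v Ow (yx n) (x_le n)) (flow_trans v Ow yy yq).
  move=> u; rewrite -[X in Aj X](oppr0 int) -(flow_y q 0%N) add0n => -[v Av <-].
  exists (flow w (y q) 0 v); first by apply: sub; exists v.
  by rewrite phiE (flow_trans v Ow yq t0).
Qed.

Lemma radius_subexponential w (r : (R -> V) -> R) (eps : R) : 0 < eps ->
  limf_esup (fun t : R => (logplus (r (theta t w)) / `|t|)%:E) (ninfty_nbhs R) = 0%E ->
  exists M, forall s, s < M -> s < 0 -> logplus (r (theta s w)) <= eps * `|s|.
Proof.
move=> eps0 h.
have : (limf_esup (fun t : R => (logplus (r (theta t w)) / `|t|)%:E) (ninfty_nbhs R) < eps%:E)%E.
  by rewrite h lte_fin.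
move=> /ereal_inf_lt [_ [A [M [_ MA]] <-]] hA'; exists M => s sM s0.
rewrite -ler_pdivrMr ?normr_gt0 ?lt_eqF// -lee_fin; apply: le_trans (ltW hA').
by apply: ereal_sup_ubound; exists s => //; exact: MA.
Qed.

Lemma stop_bracket w s : Omega w -> s <= 0 -> exists n,
  iter n.+1 (pred_stop b' mu w) 0 <= s /\ s <= iter n (pred_stop b' mu w) 0.
Proof.
move=> Ow s0; have [q hq] := pred_stop_unbounded 0 s Ow.
have ex : exists n, iter n.+1 (pred_stop b' mu w) 0 <= s.
  by exists q; apply: le_trans hq; apply: (iter_pred_mono hb (finite_b'' Ow)).
case: (ex_minnP ex) => n hn hmin; exists n; split => //.
case: n hn hmin => [|n] hn hmin //=.
rewrite leNgt; apply/negP => /ltW /(hmin n).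
by rewrite ltnn.
Qed.

Lemma attractor_attracts w D : Omega w -> DR0 Omega D ->
  hdist (phi (t : R) (theta (- t) w) @` D (theta (- t) w)) (Aj 0 w)
    @[t --> +oo%R] --> (0%:E : \bar R).
Proof.
move=> Ow [D0 [r [hr limr]]]; have fin := finite_b'' Ow.
have nup := nu0; have e0 : 0 < nu / 2 by lra.
have [M hM] := radius_subexponential e0 (limr w Ow).
pose x n := iter n (pred_stop b' mu w) 0.
have x_le n : x n <= 0 by exact: (iter_pred_top hb fin).
(* The point 0 keeps [E n] nonempty when the interval contains no admissible s; s < M restricts to
   times at which the radius bound holds. *)
pose E n : set V := [set u | u = 0 \/ exists s, [/\ s < M, s < 0, x n.+1 <= s, s <= x n &
  (flow w s (x n) @` D (theta s w)) u]].
(* The factor [K] pays for at most one stopping interval, and |s| <= n + 1 bounds the radius at s in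
   terms of the index. *)
pose rE n := K * (1 + expR (nu / 2 * (n + 1)%:R)).
have rE0 n : 0 <= rE n.
  by rewrite mulr_ge0 ?(le_trans ler01 K1)// addr_ge0 ?expR_ge0.
have Er n u : E n u -> `|u| <= rE n.
  move=> [->|[s [sM s0 xs sx [v Dv <-]]]]; first by rewrite normr0.
  apply: le_trans (_ : 1 + `|flow w s (x n) v| <= _); first by rewrite lerDr.
  have sx1 : x n <= iter 1 (succ_stop b' mu w) s.
    by have := iter_succ_pred hb fin 1 n 0; rewrite -/(x n) addn1 => <-; rewrite (iter_succ_le hb fin).
  apply: le_trans (growth_steps v Ow sx sx1) _; rewrite expr1.
  rewrite ler_wpM2l ?(le_trans ler01 K1)// lerD2l.
  have [_ hD] := hr _ (theta_Omega s Ow).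
  apply: le_trans (hD v Dv) _; apply: logplus_le_expR.
  apply: le_trans (hM s sM s0) _; rewrite ler_wpM2l ?(ltW e0)// ltr0_norm//.
  have := iter_pred_ge hb fin n.+1 0; rewrite -/(x n.+1) addn1; lra.
have trE : tempered nu rE.
  apply: (@tempered_affine _ nu (fun n => expR (nu / 2 * n%:R)) K 1 K1).
  exists (nu / 2), 0%N; split; [exact: ltW|lra|move=> n _].
  by rewrite logplus_expR// mulr_ge0// ltW.
have E0 n : E n !=set0 by exists 0; left.
have cvE := @attract w 0 E rE Ow E0 Er trE; rewrite theta0_Omega// in cvE.
(* The index of a stopping interval containing - t; for negative t any value will do. *)
have ex (t : R) : exists n, 0 <= t -> x n.+1 <= - t /\ - t <= x n.
  have [t0|t0] := leP 0 t; last by exists 0%N.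
  by have [|n hn] := @stop_bracket w (- t) Ow; [rewrite oppr_le0|exists n].
have [k hk] := choice ex.
(* From - (k t + 1) <= x (k t + 1) <= - t the index k t grows at least like t - 1. *)
have kcv : k t @[t --> +oo%R] --> \oo.
  move=> A [n _ nA]; exists (Num.max 0 (n.+1%:R)); split; first exact: num_real.
  move=> t; rewrite gt_max => /andP[t0 nt]; apply: nA => /=.
  have [h1 _] := hk t (ltW t0).
  have := iter_pred_ge hb fin (k t).+1 0; rewrite -/(x (k t).+1) => h2.
  by rewrite -ltnS -(ltr_nat R); lra.
have cvk := cvg_comp _ _ kcv cvE.
apply: (squeeze_cvge _ (cvg_cst 0%E) cvk).
exists (Num.max 0 (- M)); split; first exact: num_real.
move=> t; rewrite gt_max => /andP[t0 Mt] /=.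
have [h1 h2] := hk t (ltW t0).
have Ot := theta_Omega (- t) Ow.
apply/andP; split.
  by apply: hdist_ge0; have [[u Du] _] := D0 _ Ot; exists (phi t (theta (- t) w) u); exists u.
apply: hdist_sub => _ [u Du <-].
exists (flow w (- t) (x (k t)) u).
  right; exists (- t); split; [lra|lra|exact: h1|exact: h2|by exists u].
rewrite (flow_trans u Ow h2 (x_le _)).
by rewrite /flow sub0r opprK.
Qed.

End Comparison.

Theorem lemma3p13 (R : realType) (V : completeNormedModType R)
  (ip : V -> V -> R) (DA : set V) (A : V -> V) (S : R -> V -> V)
  (lambda1 : R) (I : countType) (e : I -> V) (lam : I -> R)
  (G : V -> V -> V) (H alpha beta beta' beta'' : R)
  (Omega : set (R -> V)) (phi : R -> (R -> V) -> V -> V)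
  (c mu k1 d nu : R) (Aj : int -> (R -> V) -> set V)
  (* the Hilbert space and the linear part *)
  (hip : inner_product ip) (hsep : separable V)
  (hlin : unbounded_linear DA A) (hsa : self_adjoint ip DA A)
  (hpos : strictly_positive_opp ip DA A) (hcpt : compact_inverse DA A)
  (hS : generates_semigroup DA A S)
  (hlambda1 : smallest_eigenvalue_opp DA A lambda1)
  (heig : eigenbasis_opp ip DA A e lam)
  (* the nonlinearity, the exponents and the driving paths *)
  (hG : C2b e G)
  (hH : 1 / 2 < H /\ H < 1)
  (hbeta : [/\ 1 / 2 < beta, beta < beta', beta' < beta'' & beta'' < H])
  (halpha : 1 - beta' < alpha /\ alpha < beta)
  (hOmega : path_space beta'' Omega)
  (* the solution and the constant c *)
  (hphi : solution_cocycle ip alpha beta S G (Vdom ip e lam beta) Omega phi)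
  (hc : apriori_constant beta beta' lambda1 (Vdom ip e lam beta)
          (Vnorm ip e lam beta) Omega phi c)
  (* the assumptions of the claim *)
  (hmu : 0 < mu) (hcmu : c * mu < 1)
  (hk1 : k1 = c * mu / (1 - c * mu)) (hk1lt : k1 < 1)
  (hk1log : 1 < - (2 / lambda1) * ln k1)
  (hd : 0 < d) (hnu : 0 <= nu /\ nu < d * lambda1 / 2) (hnud : 1 < nu + d)
  (hT : forall w, Omega w ->
     let liminfT :=
       limn_einf (fun n : nat =>
         (`|Tstop beta' mu (- n%:Z) w| / n%:R)%:E) in
     [/\ (liminfT < 1%:E)%E, (d%:E <= liminfT)%E,
         2 * (ln (1 + k1) + nu) / lambda1 <= d &
         logplus (`|stop beta' mu (theta (Tstop beta' mu (- n%:Z) w) w)|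
                    `^ (- beta)) / n%:R @[n --> \oo] --> (0 : R)])
  (hA : forall w, Omega w ->
     pullback_attractor nu (fun i j => Phi beta' mu phi i j w)
       (fun i => Aj i w)) :
  let cA := fun w => Aj 0 w in
  (forall (t : R) w, 0 <= t -> Omega w -> phi t w @` cA w = cA (theta t w)) /\
  (forall w D, Omega w -> DR0 Omega D ->
     hdist (phi (t : R) (theta (- t) w) @` D (theta (- t) w)) (cA w)
       @[t --> +oo%R] --> (0%:E : \bar R)).
Proof.
have [b12 bb' b'b'' b''H] := hbeta; have [_ H1] := hH; have [al1 alb] := halpha.
have exps : [/\ 0 < alpha, alpha < beta, beta < beta', beta' < 1 & 1 - beta' < alpha].
  by split; lra.
have hb : [/\ 0 < beta', beta' < 1, beta' < beta'' & 0 < mu] by split; lra.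
have OmegaT t w : Omega w -> Omega (theta t w).
  by have [_ _ h] := hOmega => Ow; exact: h.
(* From d <= liminf < 1 and nu + d > 1; a path is required for the first two inequalities. *)
have nu0 w : Omega w -> 0 < nu.
  move=> Ow; have [l1 ld _ _] := hT w Ow.
  by have := le_lt_trans ld l1; rewrite lte_fin; lra.
have hTd w : Omega w ->
    (d%:E <= limn_einf (fun n : nat => (`|Tstop beta' mu (- n%:Z) w| / n%:R)%:E))%E.
  by move=> Ow; have [] := hT w Ow.
have phi0 w u : Omega w -> phi 0 w u = u by move=> Ow; exact: (sol_zero hphi).
have phiD w u s t : Omega w -> 0 <= t -> 0 <= s ->
    phi (t + s) w u = phi t (theta s w) (phi s w u).
  by move=> *; exact: (sol_cocycle hphi).
have [K K1 grow] := growth hip heig hpos hS hG exps hphi OmegaT (ltW hmu).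
move=> cA; split => [t w t0 Ow|w D Ow hD].
- exact: (attractor_flow hb hOmega phi0 phiD hA hd hTd K1 grow).
- exact: (attractor_attracts hb hOmega phi0 phiD hA hd hTd (nu0 w Ow) K1 grow).
Qed.
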